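(* Let $(H,d)$ be a geodesic Gromov-hyperbolic space with basepoint $o$, and let $(M_n)$ be a non-elementary Markovian random walk on $\mathrm{Isom}(H)$ satisfying conditions $(A_1)$ and $(A_2')$. Then there exists a constant $\ell_\Lambda\ge0$ such that for every $\epsilon>0$ there exist $\alpha>0$ and $C>0$ such that for every $x\in E$, every $\xi\in\overline{H}^h$ and every $n\in\mathbb{N}$, \[ \mathbb{P}_x\big(|\sigma(M_n,\xi)-n\ell_\Lambda|\ge n\epsilon\big)\le Ce^{-\alpha n}. \]
   Context: $E$ is a countable set, $P$ an irreducible positively recurrent transition kernel on $E$ with stationary probability $\pi$, $\mathbb{P}_x$ the law of the Markov chain $(z_n)_{n\ge0}$ with $z_0=x$, $X:E\to\mathrm{Isom}(H)$ a map and $M_n=X(z_n)\cdots X(z_1)$. $H$ may be assumed separable. Horofunction compactification: for $x\in H$ let $h_x(y)=d(x,y)-d(x,o)$; $\overline{H}^h$ is the closure of $\{h_x\}$ in the space of $1$-Lipschitz functions vanishing at $o$ with the pointwise topology. Busemann cocycle: $\sigma(\gamma,h)=h(\gamma^{-1}o)$; $\kappa(\gamma)=d(\gamma o,o)$. $(A_1)$: there are $C>0,\rho\in(0,1)$ with $\|P^n(z,\cdot)-\pi\|_{TV}\le C\rho^n$ for all $z,n$. $(A_2')$: there are $a,B>0$ with $\mathbb{E}_x[e^{a\kappa(M_1)}]\le B$ for all $x\in E$. Non-elementary: there do not exist finitely many maps $V_i:E\to\partial H$ such that, with $W(x)=\bigcup_iV_i(x)$, for every $x_0\in E$ and $n$,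 $\mathbb{P}_{x_0}$-a.s. $M_nW(x_0)=W(z_n)$. *)

(* Defs.v *)
From HB Require Import structures.
From mathcomp Require Import all_boot all_order all_algebra.
From mathcomp Require Import all_classical all_reals.
From mathcomp Require Import topology normedtype sequences esum exp.
Set Implicit Arguments. Unset Strict Implicit. Unset Printing Implicit Defensive.
Import Order.TTheory GRing.Theory Num.Theory.
Local Open Scope ring_scope.
Local Open Scope classical_set_scope.

Section Geometry.
Variables (R : realType) (H : Type) (d : H -> H -> R).

Definition is_metric : Prop :=
  [/\ forall x, d x x = 0,
      forall x y, d x y = 0 -> x = y,
      forall x y, d x y = d y x
    & forall x y z, d x z <= d x y + d y z].

Definition geodesic : Prop :=
  forall x y, exists g : R -> H,
    [/\ g 0 = x, g (d x y) = y &
      forall s t, 0 <= s <= d x y -> 0 <= t <= d x y ->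
        d (g s) (g t) = `|s - t| ].

Definition gprod (w x y : H) : R := (d w x + d w y - d x y) / 2.

Definition gromov_hyperbolic : Prop :=
  exists delta : R, 0 <= delta /\
    forall w x y z, Num.min (gprod w x y) (gprod w y z) - delta <= gprod w x z.

Record isom := Isom {
  isom_fun :> H -> H;
  isom_inv : H -> H;
  isom_funK : forall x, isom_inv (isom_fun x) = x;
  isom_invK : forall y, isom_fun (isom_inv y) = y;
  isom_dist : forall x y, d (isom_fun x) (isom_fun y) = d x y }.

Definition kappa (o : H) (g : isom) : R := d (g o) o.

(* horofunction compactification: h is in the pointwise closure of
   { h_x : y |-> d(x,y) - d(x,o) } inside the 1-Lipschitz functions vanishing at o *)
Definition horo_fun (o x : H) : H -> R := fun y => d x y - d x o.

Definition in_horo_compactification (o : H) (h : H -> R) : Prop :=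
  [/\ forall y z, `|h y - h z| <= d y z,
      h o = 0 &
      forall (m : nat) (ys : 'I_m -> H) (eps : R), 0 < eps ->
        exists x, forall i, `|horo_fun o x (ys i) - h (ys i)| < eps ].

(* Gromov boundary: sequences converging at infinity, up to equivalence *)
Definition conv_infty (o : H) (u : nat -> H) : Prop :=
  forall K : R, exists N, forall m n, (N <= m)%N -> (N <= n)%N ->
    K <= gprod o (u m) (u n).

Definition bd_equiv (o : H) (u v : nat -> H) : Prop :=
  forall K : R, exists N, forall m n, (N <= m)%N -> (N <= n)%N ->
    K <= gprod o (u m) (v n).

End Geometry.

Section Markov.
Variables (R : realType) (E : countType) (P : E -> E -> R).

Fixpoint pathprob (x : E) (s : seq E) : R :=
  match s with
  | [::] => 1
  | y :: s' => P x y * pathprob y s'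
  end.

Definition Prob (x : E) (n : nat) (A : seq E -> Prop) : \bar R :=
  \esum_(s in [set s : n.-tuple E | A (val s)]) (pathprob x (val s))%:E.

Definition Pn (n : nat) (x y : E) : \bar R :=
  Prob x n (fun s => last x s = y).

Definition is_kernel : Prop :=
  (forall x y, 0 <= P x y) /\
  (forall x, \esum_(y in [set: E]) (P x y)%:E = 1%E).

Definition irreducible : Prop :=
  forall x y, exists n, (0 < Pn n x y)%E.

(* positive recurrence: E_x[tau_x] = sum_{n>=0} P_x(tau_x > n) < oo,
   tau_x = inf {n >= 1 | z_n = x} *)
Definition positively_recurrent : Prop :=
  forall x, (\esum_(n in [set: nat])
               Prob x n (fun s => all (fun z => z != x) s) < +oo)%E.

Definition stationary_probability (pi : E -> R) : Prop :=
  [/\ forall y, 0 <= pi y,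
      \esum_(y in [set: E]) (pi y)%:E = 1%E &
      forall y, \esum_(x in [set: E]) (pi x * P x y)%:E = (pi y)%:E ].

(* (A_1): uniform geometric ergodicity in total variation
   (total variation norm taken as the l^1 distance) *)
Definition cond_A1 (pi : E -> R) : Prop :=
  exists C rho : R, [/\ 0 < C, 0 < rho, rho < 1 &
    forall z n, (\esum_(y in [set: E]) `|Pn n z y - (pi y)%:E| <= (C * rho ^+ n)%:E)%E ].

End Markov.

Section Walk.
Variables (R : realType) (H : Type) (d : H -> H -> R) (E : countType).
Variables (X : E -> isom d).

Definition Minv_pt (o : H) (s : seq E) : H :=
  foldr (fun z p => isom_inv (X z) p) o s.

Definition M_pt (s : seq E) (p : H) : H :=
  foldl (fun q z => X z q) p s.

Definition sigmaM (o : H) (s : seq E) (h : H -> R) : R := h (Minv_pt o s).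

Definition cond_A2' (P : E -> E -> R) (o : H) : Prop :=
  exists a B : R, [/\ 0 < a, 0 < B &
    forall x, (\esum_(y in [set: E]) (P x y * expR (a * kappa o (X y)))%:E
                <= B%:E)%E ].

(* Non-elementary: there is no nonempty finite family of maps V_i : E -> dH
   with W(x) = U_i V_i(x) satisfying, for all x0, n, P_{x0}-a.s.
   M_n W(x0) = W(z_n). *)
Definition non_elementary (P : E -> E -> R) (o : H) : Prop :=
  ~ exists (k : nat) (V : 'I_k -> E -> nat -> H),
      [/\ (0 < k)%N,
          (forall i x, conv_infty d o (V i x)) &
          forall x0 n,
            Prob P x0 n (fun s =>
              ~ ((forall i, exists j,
                    bd_equiv d o (fun m => M_pt s (V i x0 m)) (V j (last x0 s))) /\
                 (forall j, exists i,
                    bd_equiv d o (fun m => M_pt s (V i x0 m)) (V j (last x0 s))))) = 0%E ].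

End Walk.

(* Main.v *)
(** For a horofunction [xi] write [gp xi p = (d p o - xi p) / 2], the Gromov
    product [(xi | p)_o]; then [sigma (M_n, xi) = kappa M_n - 2 gp xi (M_n^-1 o)].
    Let [gp_rate x xi] be the limit of [E_x (gp xi (M_n^-1 o)) / n] along a fixed
    non-principal ultrafilter.  Successive means differ by a bounded amount, so
    this rate is harmonic: [gp_rate x xi = sum_y P x y * gp_rate y (X y xi)].
    By hyperbolicity a point can be close to only one end, so the rates of
    pairwise inequivalent [xi_i] have bounded sum.  Hence if the maximum of the
    rate were positive it would be attained, at every state, on finitely many
    ends; by harmonicity the chain permutes these ends, contradicting
    non-elementarity.  So all rates vanish.

    With [drift = inf_n sup_x E_x (kappa M_n) / n] it follows that from a given
    state each [xi] satisfies [E (sigma (M_n, xi)) >= n (drift - e)] at some [n].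
    Compactness of the horofunctions bounds [n], and the uniform minorization
    [P^m (x, z) >= beta] given by (A_1) lets one concatenate blocks to get the
    bound uniformly in [x] and [xi] at one fixed [n].  The upper bound is
    immediate from [sigma <= kappa].  A second-order expansion of the exponential
    moment of a block of length [n], the Markov property and the Chernoff bound
    give the exponential decay. *)

Require Import Defs.
From HB Require Import structures.
From mathcomp Require Import all_boot all_order all_algebra.
From mathcomp Require Import all_classical all_reals.
From mathcomp Require Import topology ereal normedtype sequences esum exp.
From mathcomp Require Import ring lra.
Import Order.TTheory GRing.Theory Num.Theory.
Import numFieldNormedType.Exports.
Local Open Scope ring_scope.
Local Open Scope classical_set_scope.
Set Implicit Arguments. Unset Strict Implicit. Unset Printing Implicit Defensive.

(** * Signed summable series, built from nonnegative extended sums *)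

Section RealSum.
Context {R : realType} {T : choiceType}.
Implicit Types (f g u v : T -> R).

Definition nsum f : \bar R := \esum_(y in [set: T]) (f y)%:E.

(* Meaningful for summable [f] only: [fine] sends an infinite part to 0. *)
Definition rsum f : R :=
  fine (nsum (fun y => Num.max (f y) 0)%R) - fine (nsum (fun y => Num.max (- f y) 0)%R).

Lemma nsum_ge0 f : (forall y, 0 <= f y) -> (0 <= nsum f)%E.
Proof. by move=> f0; apply: esum_ge0 => y _; rewrite lee_fin. Qed.

Lemma le_nsum f g : (forall y, f y <= g y) -> (nsum f <= nsum g)%E.
Proof. by move=> fg; apply: le_esum => y _; rewrite lee_fin. Qed.

Lemma nsumD f g : (forall y, 0 <= f y) -> (forall y, 0 <= g y) ->
  nsum (fun y => f y + g y)%R = (nsum f + nsum g)%E.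
Proof.
by move=> f0 g0; rewrite /nsum -esumD// => y _; rewrite lee_fin.
Qed.

Lemma nsum_fin f : (forall y, 0 <= f y) -> (nsum f < +oo)%E ->
  nsum f = (fine (nsum f))%:E.
Proof.
by move=> f0 ffin; rewrite fineK// ge0_fin_numE ?nsum_ge0.
Qed.

(** Only one inequality needs work: applied with [c^-1] to the function [c * f], it yields the
    other. The case [c = 0] is separate. *)
Lemma nsumZ c f : 0 <= c -> (forall y, 0 <= f y) ->
  nsum (fun y => c * f y)%R = (c%:E * nsum f)%E.
Proof.
move=> c0 f0.
have key (c' : R) (h : T -> R) : 0 <= c' -> (forall y, 0 <= h y) ->
    (nsum (fun y => c' * h y)%R <= c'%:E * nsum h)%E.
  move=> c'0 h0; apply: ge_ereal_sup => _ [X [finX XT] <-].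
  under eq_fsbigr do rewrite EFinM.
  rewrite -ge0_mule_fsumr; last by move=> y; rewrite lee_fin.
  apply: lee_pmul => //; first by apply: fsume_ge0 => y _; rewrite lee_fin.
  by apply: ereal_sup_ubound; exists X.
apply/eqP; rewrite eq_le key//=.
have [->|c_neq0] := eqVneq c 0.
  by rewrite mul0e nsum_ge0// => y; rewrite mul0r.
have c_gt0 : 0 < c by rewrite lt_def c_neq0.
have H : (nsum f <= c^-1%:E * nsum (fun y => c * f y)%R)%E.
  apply: le_trans (key c^-1 (fun y => c * f y) _ _); rewrite ?invr_ge0//.
    by apply: le_nsum => y; rewrite mulKf.
  by move=> y; rewrite mulr_ge0.
apply: le_trans (lee_wpmul2l _ H) _; first by rewrite lee_fin.
by rewrite muleA -EFinM mulfV// mul1e.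
Qed.

(** If [fp] and [fm] are the positive and negative parts of [f], then [fp + v = u + fm] pointwise,
    and additivity on nonnegative functions concludes. Linearity of [rsum] follows by convenient
    choices of [u] and [v]. *)
Lemma rsum_split u v f : (forall y, 0 <= u y) -> (forall y, 0 <= v y) ->
  (nsum u < +oo)%E -> (nsum v < +oo)%E ->
  (forall y, f y = u y - v y) -> rsum f = fine (nsum u) - fine (nsum v).
Proof.
move=> u0 v0 ufin vfin fE.
pose fp y := Num.max (f y) 0; pose fm y := Num.max (- f y) 0.
have fp0 y : 0 <= fp y by rewrite le_max lexx orbT.
have fm0 y : 0 <= fm y by rewrite le_max lexx orbT.
have fpfin : (nsum fp < +oo)%E.
  apply: le_lt_trans ufin; apply: le_nsum => y.
  by rewrite /fp fE ge_max u0 andbT; have := v0 y; lra.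
have fmfin : (nsum fm < +oo)%E.
  apply: le_lt_trans vfin; apply: le_nsum => y.
  by rewrite /fm fE ge_max v0 andbT; have := u0 y; lra.
have : nsum (fun y => fp y + v y)%R = nsum (fun y => u y + fm y)%R.
  congr nsum; apply/funext => y; rewrite /fp /fm fE.
  by case: (leP (u y - v y) 0) => h1; case: (leP (- (u y - v y)) 0) => h2; lra.
rewrite !nsumD// (nsum_fin fp0 fpfin) (nsum_fin v0 vfin) (nsum_fin u0 ufin).
rewrite (nsum_fin fm0 fmfin) -!EFinD => -[].
by rewrite /rsum -/fp -/fm; lra.
Qed.

Lemma rsum_nonneg f : (forall y, 0 <= f y) -> (nsum f < +oo)%E ->
  nsum f = (rsum f)%:E.
Proof.
move=> f0 ffin; have n0 : nsum (fun _ : T => 0 : R) = 0%E by apply: esum1.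
rewrite (@rsum_split f (fun _ => 0)) ?n0//.
  by rewrite /= subr0 -nsum_fin.
by move=> y; rewrite subr0.
Qed.

Definition rsummable f := (nsum (fun y => `|f y|)%R < +oo)%E.

Lemma rsummable_le f g : (forall y, `|f y| <= g y) -> (nsum g < +oo)%E -> rsummable f.
Proof. by move=> fg; apply: le_lt_trans; apply: le_nsum. Qed.

Lemma rsum_parts f : rsummable f ->
  [/\ nsum (fun y => Num.max (f y) 0)%R < +oo & nsum (fun y => Num.max (- f y) 0)%R < +oo]%E.
Proof.
by move=> fs; split; apply: le_lt_trans fs; apply: le_nsum => y;
  rewrite ge_max normr_ge0 andbT ?ler_norm// -normrN ler_norm.
Qed.

Let partE (x : R) : x = Num.max x 0 - Num.max (- x) 0.
Proof. by case: (leP x 0) => h1; case: (leP (- x) 0) => h2; lra. Qed.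

Let part0 (x : R) : 0 <= Num.max x 0.
Proof. by rewrite le_max lexx orbT. Qed.

Lemma rsumD f g : rsummable f -> rsummable g ->
  rsum (fun y => f y + g y) = rsum f + rsum g.
Proof.
move=> fs gs; have [f1 f2] := rsum_parts fs; have [g1 g2] := rsum_parts gs.
rewrite (@rsum_split (fun y => Num.max (f y) 0 + Num.max (g y) 0)
  (fun y => Num.max (- f y) 0 + Num.max (- g y) 0)).
- rewrite !nsumD// !fineD ?ge0_fin_numE ?nsum_ge0//; rewrite /rsum; ring.
- by move=> y; rewrite addr_ge0.
- by move=> y; rewrite addr_ge0.
- by rewrite nsumD// lte_add_pinfty.
- by rewrite nsumD// lte_add_pinfty.
- by move=> y; rewrite {1}(partE (f y)) {1}(partE (g y)); ring.
Qed.

Lemma rsumN f : rsum (fun y => - f y) = - rsum f.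
Proof.
by rewrite /rsum opprB; congr (_ - fine (nsum _)); apply/funext => y; rewrite opprK.
Qed.

Lemma rsumZ c f : rsummable f -> rsum (fun y => c * f y) = c * rsum f.
Proof.
move=> fs; have [f1 f2] := rsum_parts fs.
have pos (c' : R) : 0 <= c' -> rsum (fun y => c' * f y) = c' * rsum f.
  move=> c0.
  rewrite (@rsum_split (fun y => c' * Num.max (f y) 0) (fun y => c' * Num.max (- f y) 0)).
  - have fin h : (forall y, 0 <= h y) -> (nsum h < +oo)%E -> nsum h \is a fin_num.
      by move=> h0 hfin; rewrite ge0_fin_numE ?nsum_ge0.
    by rewrite !nsumZ// !fineM ?fin// /rsum /= mulrBr.
  - by move=> y; rewrite mulr_ge0.
  - by move=> y; rewrite mulr_ge0.
  - by rewrite nsumZ// lte_mul_pinfty ?lee_fin// nsum_ge0.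
  - by rewrite nsumZ// lte_mul_pinfty ?lee_fin// nsum_ge0.
  - by move=> y; rewrite {1}(partE (f y)); ring.
have [c0|c0] := leP 0 c; first exact: pos.
transitivity (rsum (fun y => - (- c * f y))).
  by congr rsum; apply/funext => y; ring.
by rewrite rsumN pos ?oppr_ge0 ?ltW//; ring.
Qed.

Lemma rsum_ge0 f : (forall y, 0 <= f y) -> 0 <= rsum f.
Proof.
move=> f0; rewrite /rsum (_ : nsum (fun y => Num.max (- f y) 0)%R = 0%E) /= ?subr0.
  by apply: fine_ge0; apply: nsum_ge0.
by apply: esum1 => y _; congr (_%:E); apply/max_idPr; rewrite oppr_le0.
Qed.

Lemma rsummableD f g : rsummable f -> rsummable g -> rsummable (fun y => f y + g y).
Proof.
move=> fs gs; apply: (@rsummable_le _ (fun y => `|f y| + `|g y|)).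
  by move=> y; exact: ler_normD.
by rewrite nsumD// lte_add_pinfty.
Qed.

Lemma rsummableZ c f : rsummable f -> rsummable (fun y => c * f y).
Proof.
move=> fs; apply: (@rsummable_le _ (fun y => `|c| * `|f y|)).
  by move=> y; rewrite normrM.
by rewrite nsumZ// lte_mul_pinfty ?lee_fin// nsum_ge0.
Qed.

Lemma ler_rsum f g : rsummable f -> rsummable g -> (forall y, f y <= g y) ->
  rsum f <= rsum g.
Proof.
move=> fs gs fg; rewrite -subr_ge0 -mulN1r -rsumZ// -rsumD//; last exact: rsummableZ.
by apply: rsum_ge0 => y; rewrite mulN1r subr_ge0.
Qed.

Lemma rsum_ge_seq f (r : seq T) : uniq r -> (forall y, 0 <= f y) -> rsummable f ->
  \sum_(y <- r) f y <= rsum f.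
Proof.
move=> ur f0 fs.
have ffin : (nsum f < +oo)%E.
  apply: le_lt_trans fs; apply: le_nsum => y; exact: ler_norm.
rewrite -lee_fin -rsum_nonneg//; apply: esum_ge; exists [set` r].
  by split => //; exact: finite_seq.
by rewrite -fsbig_seq//= sumEFin.
Qed.

Lemma nsum_le_seq f (c : \bar R) : (forall y, 0 <= f y) ->
  (forall r : seq T, uniq r -> ((\sum_(y <- r) f y)%:E <= c)%E) -> (nsum f <= c)%E.
Proof.
move=> f0 H; apply: ge_ereal_sup => _ [A [finA _] <-].
by rewrite fsbig_finite//= sumEFin; exact: H.
Qed.

Lemma rsum_le_seq f c : (forall y, 0 <= f y) ->
  (forall r : seq T, uniq r -> \sum_(y <- r) f y <= c) -> rsum f <= c.
Proof.
move=> f0 H; have le : (nsum f <= c%:E)%E.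
  by apply: nsum_le_seq => // r /H; rewrite lee_fin.
by rewrite -lee_fin -rsum_nonneg// (le_lt_trans le)// ltry.
Qed.

End RealSum.

(** * Limits along an ultrafilter and dominated convergence *)

Section UltraLimit.
Context {R : realType} (U : set_system nat) {UU : UltraFilter U}.

Definition ulim (u : nat -> R) : R := lim (u @ U).

(** The image of an ultrafilter is an ultrafilter, so compactness of [[-b, b]] provides the
    limit. *)
Lemma ulim_cvg u (b : R) : (forall n, `|u n| <= b) -> u @ U --> ulim u.
Proof.
move=> ub; apply/cvg_ex.
have := @segment_compact R (- b) b; rewrite compact_ultra => /(_ (u @ U)).
have uU : UltraFilter (u @ U).
  split; first exact: fmap_proper_filter.
  move=> G GF UG; apply/seteqP; split => // A GA.
  have [//|UC] := in_ultra_setVsetC (u @^-1` A) UU.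
  have : G (~` A) by apply: UG.
  by move=> /(filterI GA); rewrite setICr => /filter_not_empty.
move=> /(_ uU) H; have [|l [_ ul]] := H; last by exists l.
change (U (u @^-1` `[- b, b])); apply: filterE => n /=.
by rewrite in_itv/= -ler_norml.
Qed.

Lemma cvg_bigsum {I : Type} (r : seq I) (f_ : nat -> I -> R) (f : I -> R) :
  (forall i, (fun n => f_ n i) @ U --> f i) ->
  (fun n => \sum_(i <- r) f_ n i) @ U --> \sum_(i <- r) f i.
Proof.
move=> ff; elim: r => [|i r IH].
  by under eq_fun do rewrite big_nil; rewrite big_nil; exact: cvg_cst.
by under eq_fun do rewrite big_cons; rewrite big_cons; apply: cvgD (IH); exact: ff.
Qed.

(** Dominated convergence: Fatou's inequality is applied to [G + g_n] and to [G - g_n]. The bounded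
    sums already have an ultralimit, so only its value has to be identified. *)
Lemma rsum_cvg {T : choiceType} (g_ : nat -> T -> R) (g G : T -> R) :
  (forall n y, `|g_ n y| <= G y) -> (nsum G < +oo)%E ->
  (forall y, (fun n => g_ n y) @ U --> g y) ->
  (fun n => rsum (g_ n)) @ U --> rsum g.
Proof.
move=> gG Gfin g_g.
have G0 y : 0 <= G y by apply: le_trans (gG 0%N y).
have sG : rsummable G by apply: rsummable_le Gfin => y; rewrite ger0_norm.
have sg_ n : rsummable (g_ n) by apply: rsummable_le Gfin.
have gle y : `|g y| <= G y.
  by apply: (cvgr_to_le (cvg_norm (g_g y))); apply: nearW => n; exact: gG.
have sg : rsummable g by apply: rsummable_le Gfin.
have bnd n : `|rsum (g_ n)| <= rsum G.
  rewrite ler_norml; apply/andP; split.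
    rewrite -rsumN; apply: ler_rsum => //.
      by apply: rsummable_le Gfin => y; rewrite normrN ger0_norm.
    by move=> y; have := gG n y; rewrite ler_norml => /andP[].
  by apply: ler_rsum => // y; have := gG n y; rewrite ler_norml => /andP[].
have key (h_ : nat -> T -> R) h l : (forall n y, `|h_ n y| <= G y) ->
    (forall y, `|h y| <= G y) -> (forall y, (fun n => h_ n y) @ U --> h y) ->
    (fun n => rsum (h_ n)) @ U --> l -> rsum h <= l.
  move=> hG hle h_h hl.
  have sh_ n : rsummable (h_ n) by apply: rsummable_le Gfin.
  have sh : rsummable h by apply: rsummable_le Gfin.
  suff : rsum (fun y => G y + h y) <= rsum G + l by rewrite rsumD// lerD2l.
  apply: rsum_le_seq => [y|r ur].
    by have := hle y; rewrite ler_norml => /andP[+ _]; rewrite -subr_ge0 opprK addrC.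
  have H1 : (fun n => \sum_(y <- r) (G y + h_ n y)) @ U --> \sum_(y <- r) (G y + h y).
    by apply: cvg_bigsum => y; apply: cvgD (h_h y); exact: cvg_cst.
  have H2 : (fun n => rsum G + rsum (h_ n)) @ U --> rsum G + l.
    by apply: cvgD => //; exact: cvg_cst.
  apply: (ler_cvg_to H1 H2); apply: nearW => n; rewrite -rsumD//.
  apply: rsum_ge_seq => // [y|]; last exact: rsummableD.
  by have := hG n y; rewrite ler_norml => /andP[+ _]; rewrite -subr_ge0 opprK addrC.
have cl := ulim_cvg bnd.
suff -> : rsum g = ulim (fun n => rsum (g_ n)) by [].
apply/eqP; rewrite eq_le; apply/andP; split; first exact: (key g_).
rewrite -lerN2 -rsumN; apply: (key (fun n y => - g_ n y)).
- by move=> n y; rewrite normrN.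
- by move=> y; rewrite normrN.
- by move=> y; apply: cvgN.
- by under eq_fun do rewrite rsumN; apply: cvgN.
Qed.

End UltraLimit.

(** * One-step averages and expectations of path functionals *)

Section Expectation.
Context {R : realType} {E : countType} (P : E -> E -> R).
Implicit Types (a c : R) (f g : E -> R) (F G : seq E -> R).

Definition step (x : E) (f : E -> R) : R := rsum (fun y => P x y * f y).

(** Iterated one-step averages take the place of a measure on path space; [F] reads [z_1, ..., z_n]
    without the starting state. *)
Fixpoint expect (n : nat) (x : E) (F : seq E -> R) : R :=
  if n is n'.+1 then step x (fun y => expect n' y (fun s => F (y :: s))) else F [::].

(** This is the Markov property at time [n]: the future restarts from [last x s]. *)
Lemma expectD n m x F : expect (n + m) x F =
  expect n x (fun s => expect m (last x s) (fun t => F (s ++ t))).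
Proof.
elim: n x F => //= n IH x F; rewrite /step; congr rsum.
by apply/funext => y; rewrite IH.
Qed.

Hypothesis kerP : is_kernel P.
(** An abstract weight with uniformly bounded one-step mean; it is later specialized to [wexp],
    which encodes the exponential moment condition. *)
Variables (w : E -> R) (B : R).
Hypothesis w1 : forall y, 1 <= w y.
Hypothesis wB : forall x, (nsum (fun y => P x y * w y)%R <= B%:E)%E.

Let P0 x y : 0 <= P x y. Proof. by case: kerP. Qed.
Let w0 y : 0 <= w y. Proof. exact: le_trans (w1 y). Qed.
Let Pw0 x y : 0 <= P x y * w y. Proof. exact: mulr_ge0. Qed.
Let Pwfin x : (nsum (fun y => P x y * w y)%R < +oo)%E.
Proof. exact: le_lt_trans (wB x) (ltry _). Qed.

Lemma bound_ge0 (x : E) c f : (forall y, `|f y| <= c * w y) -> 0 <= c.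
Proof.
move=> /(_ x) /(le_trans (normr_ge0 _)); rewrite pmulr_lge0//.
exact: lt_le_trans (w1 x).
Qed.

Lemma step_summable x c f : (forall y, `|f y| <= c * w y) ->
  rsummable (fun y => P x y * f y).
Proof.
move=> fc; apply: (@rsummable_le _ _ _ (fun y => c * (P x y * w y))).
  by move=> y; rewrite normrM (ger0_norm (P0 x y)) mulrCA; apply: ler_wpM2l.
by rewrite nsumZ// ?lte_mul_pinfty ?lee_fin// (bound_ge0 x fc).
Qed.

Lemma stepD x c1 c2 f g : (forall y, `|f y| <= c1 * w y) -> (forall y, `|g y| <= c2 * w y) ->
  step x (fun y => f y + g y) = step x f + step x g.
Proof.
move=> fc gc; rewrite /step -rsumD; first by congr rsum; apply/funext => y; rewrite mulrDr.
  exact: step_summable fc.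
exact: step_summable gc.
Qed.

Lemma stepZ x c a f : (forall y, `|f y| <= c * w y) ->
  step x (fun y => a * f y) = a * step x f.
Proof.
move=> fc; rewrite /step -rsumZ; last exact: step_summable fc.
by congr rsum; apply/funext => y; rewrite mulrCA.
Qed.

Lemma step_le x c1 c2 f g : (forall y, `|f y| <= c1 * w y) -> (forall y, `|g y| <= c2 * w y) ->
  (forall y, f y <= g y) -> step x f <= step x g.
Proof.
move=> fc gc fg; apply: ler_rsum; [exact: step_summable fc|exact: step_summable gc|].
by move=> y; apply: ler_wpM2l.
Qed.

Lemma step_cst x c : step x (fun=> c) = c.
Proof.
have -> : (fun=> c) = (fun y : E => c * 1) by apply/funext => y; rewrite mulr1.
rewrite (@stepZ x 1 c (fun=> 1)); last by move=> y; rewrite normr1 mul1r.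
rewrite /step (_ : rsum _ = 1) ?mulr1//; under eq_fun do rewrite mulr1.
have [_ /(_ x) P1] := kerP.
by apply: EFin_inj; rewrite -rsum_nonneg ///nsum P1// ltry.
Qed.

Lemma step_w x : step x w <= B.
Proof. by rewrite -lee_fin /step -rsum_nonneg. Qed.

Lemma B_ge1 (x : E) : 1 <= B.
Proof.
apply: le_trans (step_w x); rewrite -{1}(step_cst x 1).
apply: (@step_le x 1 1) => // y; rewrite mul1r ?normr1//.
by rewrite ger0_norm.
Qed.

Lemma step_abs x c f : (forall y, `|f y| <= c * w y) -> `|step x f| <= c * B.
Proof.
move=> fc; have c0 := bound_ge0 x fc.
have cw y : `|c * w y| <= c * w y by rewrite ger0_norm ?mulr_ge0.
have cw2 y : `|- c * w y| <= c * w y by rewrite mulNr normrN ger0_norm ?mulr_ge0.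
have ww y : `|w y| <= 1 * w y by rewrite mul1r ger0_norm.
have h : c * step x w <= c * B by apply: ler_wpM2l => //; exact: step_w.
rewrite ler_norml; apply/andP; split.
  apply: le_trans (_ : step x (fun y => - c * w y) <= _).
    by rewrite (stepZ x (-c) ww); lra.
  apply: (step_le x cw2 fc) => y; have := fc y; rewrite ler_norml => /andP[]; lra.
apply: le_trans (_ : step x (fun y => c * w y) <= _).
  apply: (step_le x fc cw) => y; have := fc y; rewrite ler_norml => /andP[]; lra.
by rewrite (stepZ x c ww).
Qed.

Lemma step_ge1 x y c f : (forall y, 0 <= f y <= c * w y) -> P x y * f y <= step x f.
Proof.
move=> fc; have := @rsum_ge_seq R E (fun y => P x y * f y) [:: y] isT.
rewrite big_seq1; apply.
  by move=> z; apply: mulr_ge0 => //; have /andP[] := fc z.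
by apply: (@step_summable x c) => z; have /andP[h1 h2] := fc z; rewrite ger0_norm.
Qed.

Lemma step_cvg (U : set_system nat) {UU : UltraFilter U} x c (f_ : nat -> E -> R) f :
  (forall n y, `|f_ n y| <= c * w y) ->
  (forall y, (fun n => f_ n y) @ U --> f y) ->
  (fun n => step x (f_ n)) @ U --> step x f.
Proof.
move=> fc ff.
have c0 := bound_ge0 x (fc 0%N).
apply: (@rsum_cvg _ _ _ _ _ _ (fun y => c * (P x y * w y))).
- by move=> n y; rewrite normrM (ger0_norm (P0 x y)) mulrCA; apply: ler_wpM2l.
- by rewrite nsumZ// lte_mul_pinfty ?lee_fin.
- by move=> y; apply: cvgM; [exact: cvg_cst|].
Qed.

(** * Path functionals dominated by a multiplicative weight *)

Definition weight (s : seq E) : R := \prod_(z <- s) w z.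

(* [expect] is linear and monotone on this class; it contains every path functional
   of exponential growth at most [a] in the displacement. *)
Definition dominated (F : seq E -> R) := exists c, forall s, `|F s| <= c * weight s.

Lemma weight_ge1 s : 1 <= weight s.
Proof.
rewrite /weight; elim: s => [|z s IH]; first by rewrite big_nil.
by rewrite big_cons mulr_ege1.
Qed.

Lemma weight_cons z s : weight (z :: s) = w z * weight s.
Proof. by rewrite /weight big_cons. Qed.

Lemma weight_cat s t : weight (s ++ t) = weight s * weight t.
Proof. by rewrite /weight big_cat. Qed.

Lemma expect_abs n x c F : (forall s, `|F s| <= c * weight s) ->
  `|expect n x F| <= c * B ^+ n.
Proof.
elim: n x c F => [|n IH] x c F Fc /=.
  by have := Fc [::]; rewrite /weight big_nil expr0.
rewrite exprSr mulrA; apply: step_abs => y.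
rewrite mulrAC; apply: IH => s; have := Fc (y :: s).
by rewrite weight_cons mulrA.
Qed.

Lemma dominated_cons y F : dominated F -> dominated (fun s => F (y :: s)).
Proof.
move=> [c Fc]; exists (c * w y) => s; have := Fc (y :: s).
by rewrite weight_cons mulrA.
Qed.

Lemma dominated_cat s F : dominated F -> dominated (fun t => F (s ++ t)).
Proof.
move=> [c Fc]; exists (c * weight s) => t; have := Fc (s ++ t).
by rewrite weight_cat mulrA.
Qed.

Lemma dominated_step_arg n F : dominated F ->
  exists c, forall y, `|expect n y (fun s => F (y :: s))| <= c * w y.
Proof.
move=> [c Fc]; exists (c * B ^+ n) => y.
rewrite mulrAC; apply: expect_abs => s; have := Fc (y :: s).
by rewrite weight_cons mulrA.
Qed.

Lemma dominated_expect n x F : dominated F ->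
  dominated (fun s => expect n (last x s) (fun t => F (s ++ t))).
Proof.
move=> [c Fc]; exists (c * B ^+ n) => s; rewrite mulrAC; apply: expect_abs => t.
by have := Fc (s ++ t); rewrite weight_cat mulrA.
Qed.

Lemma dominated_le F G : (forall s, `|F s| <= G s) -> dominated G -> dominated F.
Proof.
move=> FG [c Gc]; exists c => s; apply: le_trans (Gc s).
exact: le_trans (FG s) (ler_norm _).
Qed.

Lemma dominatedD F G : dominated F -> dominated G -> dominated (fun s => F s + G s).
Proof.
move=> [c Fc] [c' Gc]; exists (c + c') => s; rewrite mulrDl.
exact: le_trans (ler_normD _ _) (lerD _ _).
Qed.

Lemma dominatedZ a F : dominated F -> dominated (fun s => a * F s).
Proof.
move=> [c Fc]; exists (`|a| * c) => s; rewrite normrM -mulrA.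
exact: ler_wpM2l.
Qed.

Lemma dominated_cst a : dominated (fun=> a).
Proof. by exists `|a| => s; rewrite ler_peMr// weight_ge1. Qed.

Lemma eq_expect n x F G : (forall s, F s = G s) -> expect n x F = expect n x G.
Proof. by move=> /funext ->. Qed.

Lemma expect_cst n x c : expect n x (fun=> c) = c.
Proof.
elim: n x => //= n IH x; rewrite -[RHS](step_cst x); congr step.
by apply/funext => y.
Qed.

Lemma expect_add n x F G : dominated F -> dominated G ->
  expect n x (fun s => F s + G s) = expect n x F + expect n x G.
Proof.
elim: n x F G => //= n IH x F G dF dG.
have [c Fc] := dominated_step_arg n dF; have [c' Gc] := dominated_step_arg n dG.
rewrite -(stepD x Fc Gc); congr step; apply/funext => y.
by apply: IH; exact: dominated_cons.
Qed.

Lemma expect_scale n x a F : dominated F ->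
  expect n x (fun s => a * F s) = a * expect n x F.
Proof.
elim: n x F => //= n IH x F dF; have [c Fc] := dominated_step_arg n dF.
rewrite -(stepZ x a Fc); congr step; apply/funext => y.
by apply: IH; exact: dominated_cons.
Qed.

Lemma expect_sub n x F G : dominated F -> dominated G ->
  expect n x (fun s => F s - G s) = expect n x F - expect n x G.
Proof.
move=> dF dG; have dG' := dominatedZ (-1) dG.
transitivity (expect n x (fun s => F s + -1 * G s)).
  by apply: eq_expect => s; rewrite mulN1r.
by rewrite expect_add// expect_scale// mulN1r.
Qed.

Lemma expect_le n x F G : dominated F -> dominated G -> (forall s, F s <= G s) ->
  expect n x F <= expect n x G.
Proof.
elim: n x F G => //= n IH x F G dF dG FG.
have [c Fc] := dominated_step_arg n dF; have [c' Gc] := dominated_step_arg n dG.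
by apply: (step_le x Fc Gc) => y; apply: IH => //; exact: dominated_cons.
Qed.

Lemma expect_ge0 n x F : dominated F -> (forall s, 0 <= F s) -> 0 <= expect n x F.
Proof.
by move=> dF F0; rewrite -(expect_cst n x 0); apply: expect_le => //; exact: dominated_cst.
Qed.

Lemma expect_sum k n x (F : nat -> seq E -> R) : (forall i, dominated (F i)) ->
  expect n x (fun s => \sum_(i < k) F i s) = \sum_(i < k) expect n x (F i).
Proof.
move=> dF; elim: k => [|k IH].
  rewrite big_ord0 -[RHS](expect_cst n x 0).
  by apply: eq_expect => s; rewrite big_ord0.
rewrite big_ord_recr /= -IH -expect_add//.
  by apply: eq_expect => s; rewrite big_ord_recr.
elim: k {IH} => [|k IH].
  by under eq_fun do rewrite big_ord0; exact: dominated_cst.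
by under eq_fun do rewrite big_ord_recr; exact: dominatedD.
Qed.

Lemma expect_cvg (U : set_system nat) {UU : UltraFilter U} n x c (F_ : nat -> seq E -> R) F :
  (forall k s, `|F_ k s| <= c * weight s) ->
  (forall s, (fun k => F_ k s) @ U --> F s) ->
  (fun k => expect n x (F_ k)) @ U --> expect n x F.
Proof.
elim: n x c F_ F => [|n IH] x c F_ F Fc FF /=; first exact: FF.
have dom y k s : `|F_ k (y :: s)| <= c * w y * weight s.
  by have := Fc k (y :: s); rewrite weight_cons mulrA.
apply: (step_cvg (c := c * B ^+ n)).
  by move=> k y; rewrite mulrAC; apply: expect_abs; exact: dom.
by move=> y; apply: (IH _ _ _ _ (dom y)).
Qed.

(** Splitting a tuple into head and tail turns the sum of path probabilities into iterated one-step
    sums. This links the probabilities of the theorem to [expect]. *)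
Lemma ProbE n x (A : seq E -> Prop) :
  Prob P x n A = (expect n x (fun s => (`[< A s >])%:R))%:E.
Proof.
elim: n x A => [|n IH] x A /=.
  rewrite /Prob; case: asboolP => [A0|nA0].
    rewrite (_ : [set _ | _] = [set [tuple]]).
      by rewrite esum_set1//= lee_fin.
    by apply/seteqP; split => [t|t ->]//= _; rewrite tuple0.
  rewrite esum1// => t /=; rewrite tuple0 => /nA0 [].
rewrite /Prob.
have pp0 m z (s : m.-tuple E) : 0 <= pathprob P z s.
  case: s => s _ /=; elim: s z => //= y s IHs z; exact: mulr_ge0.
rewrite (reindex_esum ([set: E] `*`` (fun y => [set t : n.-tuple E | A (y :: t)])) _
   (fun p : E * n.-tuple E => [tuple of p.1 :: p.2])); last first.
  split.
  - by move=> [y t] /= [_ At].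
  - move=> [y t] [y' t'] _ _ /(congr1 val) /= [-> tt']; congr pair; exact: val_inj.
  - move=> t /= At; exists (thead t, [tuple of behead t]) => /=.
      by split => //; rewrite -[_ :: _]/(tval [tuple of thead t :: behead t]) -tuple_eta.
    by rewrite -tuple_eta.
rewrite -(@esum_esum _ _ _ _ _ (fun y t => (P x y * pathprob P y (val t))%:E))/=;
  last by move=> y t _ _; rewrite lee_fin mulr_ge0.
pose f y := expect n y (fun s => (`[< A (y :: s) >])%:R).
have dA y : dominated (fun s => (`[< A (y :: s) >])%:R).
  exists 1 => s; rewrite mul1r; apply: le_trans (weight_ge1 s).
  by case: asbool; rewrite ?normr1 ?normr0.
have f0 y : 0 <= f y by apply: expect_ge0 => // s; case: asbool.
have f1 y : f y <= 1.
  rewrite -(expect_cst n y 1); apply: expect_le => //; first exact: dominated_cst.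
  by move=> s; case: asbool.
rewrite /step -rsum_nonneg; last 2 first.
- by move=> y; exact: mulr_ge0 (P0 x y) (f0 y).
- have sm : rsummable (fun y => P x y * f y).
    apply: (@step_summable x 1) => y; rewrite ger0_norm// mul1r.
    exact: le_trans (f1 y) (w1 y).
  by apply: le_lt_trans sm; apply: le_nsum => y; exact: ler_norm.
apply: eq_esum => y _; rewrite EFinM -IH /Prob.
rewrite [in LHS]esum_mkcond [in RHS]esum_mkcond.
pose q t := if t \in [set t : n.-tuple E | A (y :: t)] then pathprob P y t else 0.
have H := @nsumZ R (n.-tuple E) (P x y) q (P0 x y).
transitivity (\esum_(t in [set: n.-tuple E]) (P x y * q t)%:E)%E.
  by apply: eq_esum => t _; rewrite /q; case: ifP; rewrite ?mulr0.
rewrite -/(nsum _) H; last by move=> t; rewrite /q; case: ifP.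
by congr (_ * _)%E; apply: eq_esum => t _; rewrite /q; case: ifP.
Qed.

End Expectation.

(** * Horofunctions and their Gromov products *)

Section Horofunctions.
Context {R : realType} {H : Type} (d : H -> H -> R) (o : H).
Hypothesis metd : is_metric d.

Let dxx x : d x x = 0. Proof. by case: metd. Qed.
Let dC x y : d x y = d y x. Proof. by case: metd. Qed.
Let dT x y z : d x z <= d x y + d y z. Proof. by case: metd. Qed.
Let d0 x y : 0 <= d x y.
Proof. by have := dT x y x; rewrite dxx (dC y x); lra. Qed.

Definition horo := {h : H -> R | in_horo_compactification d o h}.
Implicit Types (xi eta : horo) (p q : H).

Lemma horo_lip xi p q : `|sval xi p - sval xi q| <= d p q.
Proof. by case: (svalP xi). Qed.

Lemma horo_o xi : sval xi o = 0.
Proof. by case: (svalP xi). Qed.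

Lemma horo_norm xi p : `|sval xi p| <= d p o.
Proof. by rewrite -[sval xi p]subr0 -(horo_o xi) horo_lip. Qed.

Lemma horo_fun_compactification x : in_horo_compactification d o (horo_fun d o x).
Proof.
split => [y z||m ys e e0]; rewrite /horo_fun.
- rewrite ler_norml; apply/andP; split; first by have := dT x y z; lra.
  by have := dT x z y; rewrite (dC z y); lra.
- by rewrite subrr.
- by exists x => i; rewrite subrr normr0.
Qed.

Definition horo_pt x : horo := exist _ _ (horo_fun_compactification x).

Definition gp xi p : R := (d p o - sval xi p) / 2.

Lemma gp_ge0 xi p : 0 <= gp xi p.
Proof. by have := horo_norm xi p; rewrite /gp ler_norml => /andP[]; lra. Qed.

Lemma gp_le xi p : gp xi p <= d p o.
Proof. by have := horo_norm xi p; rewrite /gp ler_norml => /andP[]; lra. Qed.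

Lemma gp_lip xi p q : `|gp xi p - gp xi q| <= d p q.
Proof.
have := horo_lip xi p q; rewrite /gp !ler_norml => /andP[h1 h2].
by apply/andP; split; have := dT p q o; have := dT q p o; rewrite (dC q p); lra.
Qed.

(** Two simultaneous test points are enough to carry the four-point inequality from points of [H] to
    horofunctions with the same [delta]. *)
Lemma gp_approx xi p q e : 0 < e ->
  exists x, `|gprod d o x p - gp xi p| < e /\ `|gprod d o x q - gp xi q| < e.
Proof.
move=> e0; have [_ _ app] := svalP xi.
have [x xP] := app 2%N (fun i : 'I_2 => if i == ord0 then p else q) e e0.
have := xP ord0; have := xP (lift ord0 ord0); rewrite /= => h1 h2.
exists x; move: h1 h2; rewrite /gprod /gp /horo_fun !ltr_norml (dC o x) (dC o p) (dC o q).
by move=> /andP[? ?] /andP[? ?]; split; apply/andP; split; lra.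
Qed.

(** * Ends of horofunctions in a hyperbolic space *)

Section Hyperbolic.
Variable delta : R.
Hypothesis hyp : forall w x y z,
  Num.min (gprod d w x y) (gprod d w y z) - delta <= gprod d w x z.

Lemma gprodC w x y : gprod d w x y = gprod d w y x.
Proof. by rewrite /gprod (dC x y); lra. Qed.

Lemma gp_hyp1 xi p q : Num.min (gp xi p) (gp xi q) - delta <= gprod d o p q.
Proof.
apply/ler_addgt0Pr => e e0; have [x []] := gp_approx xi p q e0.
rewrite !ltr_norml => /andP[h1 h2] /andP[h3 h4].
have := hyp o p x q; rewrite (gprodC o p x).
by case: (leP (gprod d o x p)) => ?; case: (leP (gp xi p)) => ?; lra.
Qed.

Lemma gp_hyp2 xi p q : Num.min (gp xi p) (gprod d o p q) - delta <= gp xi q.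
Proof.
apply/ler_addgt0Pr => e e0.
have e2 : 0 < e / 2 by lra.
have [x []] := gp_approx xi p q e2.
rewrite !ltr_norml => /andP[h1 h2] /andP[h3 h4].
have := hyp o x p q.
by case: (leP (gprod d o x p)) => ?; case: (leP (gp xi p)) => ?; lra.
Qed.

(* Bounded functions such as [gp (horo_pt x)] represent no end, so [same_end] is not
   reflexive. *)
Definition same_end xi eta := forall K, exists p, K <= gp xi p /\ K <= gp eta p.

Lemma same_end_sym xi eta : same_end xi eta -> same_end eta xi.
Proof. by move=> h K; have [p []] := h K; exists p. Qed.

(** Take [q] with [gp xi q] and [gp eta q] at least [d p o], hence at least [gp xi p]. Then
    [gp_hyp1] gives [gprod d o p q >= gp xi p - delta], and [gp_hyp2] for [eta] loses one more
    [delta]. *)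
Lemma same_end_gp xi eta p : same_end xi eta -> gp xi p <= gp eta p + 2 * delta.
Proof.
move=> /(_ (d p o)) [q [q1 q2]].
have := gp_hyp1 xi p q; have := gp_hyp2 eta q p; rewrite (gprodC o q p).
have := gp_le xi p; have dd := hyp o o o o.
have : 0 <= delta.
  by move: dd; rewrite minxx; lra.
by case: (leP (gp xi p) (gp xi q)) => ?; case: (leP (gp eta q)) => ?; lra.
Qed.

Lemma same_end_trans xi eta zeta : same_end xi eta -> same_end eta zeta ->
  same_end xi zeta.
Proof.
(* The level [K] serves [xi]; the level [K + 2 * delta] serves [eta], since [2 * delta] is lost on
   passing to [zeta]. *)
move=> h1 h2 K; have [p [p1 p2]] := h1 (Num.max K (K + 2 * delta)); exists p.
have := same_end_gp p h2; move: p1 p2; rewrite !ge_max => /andP[? ?] /andP[? ?].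
by split; lra.
Qed.

(** Boundary points in [non_elementary] are sequences; this relation lets a sequence represent the
    end of a horofunction. *)
Definition tends_to (u : nat -> H) xi :=
  forall K, exists N, forall n, (N <= n)%N -> K <= gp xi (u n).

Lemma tends_to_bd_equiv u v xi : tends_to u xi -> tends_to v xi -> bd_equiv d o u v.
Proof.
move=> h1 h2 K; have [N1 N1P] := h1 (K + delta); have [N2 N2P] := h2 (K + delta).
exists (maxn N1 N2) => m n; rewrite !geq_max => /andP[m1 m2] /andP[n1 n2].
have := gp_hyp1 xi (u m) (v n); have := N1P m m1; have := N2P n n2.
by case: (leP (gp xi (u m))) => ?; lra.
Qed.

Lemma tends_to_conv_infty u xi : tends_to u xi -> conv_infty d o u.
Proof. by move=> h K; have [N NP] := tends_to_bd_equiv h h K; exists N. Qed.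

Lemma tends_to_same_end u xi eta : same_end xi eta -> tends_to u xi -> tends_to u eta.
Proof.
move=> h1 h2 K; have [N NP] := h2 (K + 2 * delta); exists N => n /NP.
by have := same_end_gp (u n) h1; lra.
Qed.

End Hyperbolic.

Lemma unbounded_tends_to xi : (forall K, exists p, K <= gp xi p) ->
  exists u, tends_to u xi.
Proof.
move=> unb; have [u uP] := choice (fun n : nat => unb n%:R).
exists u => K; exists (Num.truncn (Num.max K 0)).+1 => n Nn.
apply: le_trans (uP n).
have := truncnS_gt (Num.max K 0); have : (Num.truncn (Num.max K 0)).+1%:R <= n%:R :> R.
  by rewrite ler_nat.
have : K <= Num.max K 0 by rewrite le_max lexx.
lra.
Qed.

(** * Action of isometries on horofunctions, and compactness *)

Lemma act_compactification (g : isom d) xi :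
  in_horo_compactification d o (fun p => sval xi (isom_inv g p) - sval xi (isom_inv g o)).
Proof.
have dg p q : d (isom_inv g p) q = d p (g q).
  by rewrite -(isom_dist g) isom_invK.
split => [y z||m ys e e0].
- rewrite opprB addrA subrK; apply: le_trans (horo_lip _ _ _) _.
  by rewrite dg isom_invK.
- by rewrite subrr.
- have [_ _ app] := svalP xi; have e2 : 0 < e / 2 by lra.
  (* The additional test point [isom_inv g o] controls the constant that normalizes the translate at
     [o]; each of the two errors is below [e / 2]. *)
  have [x xP] := app m.+1 (fun i => if unlift ord0 i is Some j then isom_inv g (ys j)
     else isom_inv g o) _ e2.
  exists (g x) => i; have := xP (lift ord0 i); have := xP ord0.
  rewrite liftK unlift_none /horo_fun !(dC x) !dg !(dC _ (g x)) !ltr_norml.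
  by move=> /andP[? ?] /andP[? ?]; apply/andP; split; lra.
Qed.

Definition act (g : isom d) xi : horo := exist _ _ (act_compactification g xi).

Lemma kappa_inv (g : isom d) : d (isom_inv g o) o = kappa o g.
Proof. by rewrite /kappa -(isom_dist g) isom_invK dC. Qed.

Lemma gp_act (g : isom d) xi p : `|gp (act g xi) (g p) - gp xi p| <= kappa o g.
Proof.
rewrite /gp /= isom_funK.
have := horo_norm xi (isom_inv g o); rewrite kappa_inv ler_norml => /andP[h1 h2].
have h3 := dT (g p) (g o) o; have h4 := dT (g p) o (g o).
move: h3 h4; rewrite (dC o (g o)) isom_dist -/(kappa o g) => h3 h4.
by rewrite ler_norml; apply/andP; split; lra.
Qed.

Lemma same_end_act (g : isom d) xi eta : same_end (act g xi) (act g eta) <-> same_end xi eta.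
Proof.
split => h K; have [p [p1 p2]] := h (K + kappa o g).
  exists (isom_inv g p); have := gp_act g xi (isom_inv g p).
  have := gp_act g eta (isom_inv g p); rewrite isom_invK !ler_norml.
  by move=> /andP[? ?] /andP[? ?]; split; lra.
exists (g p); have := gp_act g xi p; have := gp_act g eta p; rewrite !ler_norml.
by move=> /andP[? ?] /andP[? ?]; split; lra.
Qed.

Lemma tends_to_act (g : isom d) u xi : tends_to u xi ->
  tends_to (fun n => g (u n)) (act g xi).
Proof.
move=> h K; have [N NP] := h (K + kappa o g); exists N => n /NP.
by have := gp_act g xi (u n); rewrite ler_norml => /andP[? ?] ?; lra.
Qed.

(** Compactness in the form used later: values at [p] stay in [[- d p o, d p o]], so pointwise
    ultralimits exist, and the defining conditions survive the limit. *)
Lemma horo_ulim (U : set_system nat) {UU : UltraFilter U} (xi_ : nat -> horo) :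
  exists xi, forall p, (fun n => sval (xi_ n) p) @ U --> sval xi p.
Proof.
pose h p := ulim U (fun n => sval (xi_ n) p).
have hP p : (fun n => sval (xi_ n) p) @ U --> h p.
  by apply: (ulim_cvg (b := d p o)) => n; exact: horo_norm.
suff hc : in_horo_compactification d o h by exists (exist _ h hc).
split => [y z||m ys e e0].
- by apply: (cvgr_to_le (cvg_norm (cvgB (hP y) (hP z)))); apply: nearW => n; exact: horo_lip.
- have h0 : (fun n => sval (xi_ n) o) @ U --> (0 : R).
    by under eq_fun do rewrite horo_o; exact: cvg_cst.
  exact: (cvg_unique _ (hP o) h0).
- have e2 : 0 < e / 2 by lra.
  have : \forall n \near U, forall i : 'I_m, `|h (ys i) - sval (xi_ n) (ys i)| < e / 2.
    by apply: filter_forall => i; move/(@cvgr_dist_lt R R): (hP (ys i)) => /(_ _ e2).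
  move=> /filter_ex [n nP]; have [_ _ app] := svalP (xi_ n).
  have [x xP] := app m ys _ e2; exists x => i; have := xP i; have := nP i.
  by rewrite !ltr_norml => /andP[? ?] /andP[? ?]; apply/andP; split; lra.
Qed.

End Horofunctions.

(** * Displacement and cocycle along a path *)

Section Walk.
Context {R : realType} {H : Type} (d : H -> H -> R) (o : H).
Context {E : countType} (P : E -> E -> R) (X : E -> isom d).
Hypothesis metd : is_metric d.
Hypothesis kerP : is_kernel P.
Variables (a B : R).
Hypothesis a0 : 0 < a.
Hypothesis momB : forall x,
  (\esum_(y in [set: E]) (P x y * expR (a * kappa o (X y)))%:E <= B%:E)%E.

Let dxx x : d x x = 0. Proof. by case: metd. Qed.
Let dC x y : d x y = d y x. Proof. by case: metd. Qed.
Let dT x y z : d x z <= d x y + d y z. Proof. by case: metd. Qed.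
Let d0 x y : 0 <= d x y.
Proof. by have := dT x y x; rewrite dxx (dC y x); lra. Qed.

Notation horo := (horo d o).
Notation act := (act metd).
Implicit Types (xi eta : horo) (s t : seq E) (F K : seq E -> R).

Definition wexp (y : E) : R := expR (a * kappa o (X y)).

Lemma wexp_ge1 y : 1 <= wexp y.
Proof. by rewrite -expR0 ler_expR; apply: mulr_ge0; [exact: ltW|exact: d0]. Qed.

Lemma wexp_mom x : (nsum (fun y => P x y * wexp y)%R <= B%:E)%E.
Proof. exact: momB. Qed.

Notation w1 := wexp_ge1.
Notation wB := wexp_mom.
Notation dom := (dominated wexp).

(** Equal to [kappa] of the product [M_n] along [s]; the form with the inverse matches [sigmaM]. *)
Definition kap s := d (Minv_pt X o s) o.

Definition actM s xi : horo := foldl (fun h z => act (X z) h) xi s.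

Lemma kap_ge0 s : 0 <= kap s.
Proof. exact: d0. Qed.

Lemma dist_inv (gm : isom d) p q : d (isom_inv gm p) (isom_inv gm q) = d p q.
Proof. by rewrite -(isom_dist gm) !isom_invK. Qed.

Lemma dist_Minv s p q : d (Minv_pt X p s) (Minv_pt X q s) = d p q.
Proof. by elim: s => //= z s IH; rewrite dist_inv. Qed.

Lemma Minv_cat s t : Minv_pt X o (s ++ t) = Minv_pt X (Minv_pt X o t) s.
Proof. by rewrite /Minv_pt foldr_cat. Qed.

Lemma kap_cat s t : kap (s ++ t) <= kap s + kap t.
Proof.
rewrite /kap Minv_cat; apply: le_trans (dT _ (Minv_pt X o s) _) _.
by rewrite dist_Minv addrC.
Qed.

Lemma kap_prefix s t : kap s <= kap (s ++ t) + kap t.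
Proof.
rewrite /kap Minv_cat; apply: le_trans (dT _ (Minv_pt X (Minv_pt X o t) s) _) _.
by rewrite dist_Minv addrC (dC o).
Qed.

Lemma kap1 y : kap [:: y] = kappa o (X y).
Proof. by rewrite /kap /= kappa_inv. Qed.

(** Subadditivity of [kap] splits the exponential over the letters of [s]. This is what makes
    displacements, the cocycle and its exponentials of rate at most [a] dominated. *)
Lemma expR_kap s : expR (a * kap s) <= weight wexp s.
Proof.
elim: s => [|y s IH].
  by rewrite /kap /= dxx mulr0 expR0 /weight big_nil.
rewrite weight_cons; apply: (@le_trans _ _ (expR (a * kappa o (X y) + a * kap s))).
  rewrite ler_expR -mulrDr; apply: ler_wpM2l; first exact: ltW.
  by rewrite -kap1; exact: (kap_cat [:: y]).
by rewrite expRD; apply: ler_wpM2l IH; rewrite expR_ge0.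
Qed.

Lemma kap_weight s : kap s <= a^-1 * weight wexp s.
Proof.
rewrite -ler_pdivrMl ?invr_gt0// invrK; apply: le_trans (expR_kap s).
by apply: le_trans (expR_ge1Dx _); lra.
Qed.

Lemma dom_kap : dom kap.
Proof. by exists a^-1 => s; rewrite ger0_norm ?kap_ge0// kap_weight. Qed.

Lemma dom_le_kap F : (forall s, `|F s| <= kap s) -> dom F.
Proof. by move=> h; apply: dominated_le h dom_kap. Qed.

Lemma sigma_le xi s : `|sigmaM X o s (sval xi)| <= kap s.
Proof. exact: horo_norm. Qed.

(** The cocycle relation for the product [M_t M_s]; the constant subtracted in [act] is exactly the
    contribution of the first letter. *)
Lemma sigma_cat xi s t : sigmaM X o (s ++ t) (sval xi) =
  sigmaM X o s (sval xi) + sigmaM X o t (sval (actM s xi)).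
Proof.
elim: s xi => [|z s IH] xi; first by rewrite /= /sigmaM /= horo_o add0r.
have cons r : sigmaM X o (z :: r) (sval xi) =
    sigmaM X o r (sval (act (X z) xi)) + sval xi (isom_inv (X z) o).
  by rewrite /sigmaM /= subrK.
by rewrite cat_cons !cons IH /=; lra.
Qed.

Lemma gp_sigma xi s : sigmaM X o s (sval xi) = kap s - 2 * gp xi (Minv_pt X o s).
Proof. by rewrite /gp /kap /sigmaM; lra. Qed.

Definition gpM xi s := gp xi (Minv_pt X o s).

Lemma gpM_ge0 xi s : 0 <= gpM xi s.
Proof. exact: gp_ge0. Qed.

Lemma gpM_le xi s : gpM xi s <= kap s.
Proof. exact: gp_le. Qed.

Lemma dom_gpM xi : dom (gpM xi).
Proof. by apply: dom_le_kap => s; rewrite ger0_norm ?gpM_ge0 ?gpM_le. Qed.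

Lemma dom_sigma xi : dom (fun s => sigmaM X o s (sval xi)).
Proof. by apply: dom_le_kap => s; exact: sigma_le. Qed.

Lemma gpM_cons xi y s : `|gpM xi (y :: s) - gpM (act (X y) xi) s| <= kappa o (X y).
Proof.
have := gp_act metd (X y) xi (Minv_pt X o (y :: s)).
by rewrite /= isom_invK distrC.
Qed.

Lemma gpM_cat xi s t : `|gpM xi (s ++ t) - gpM xi s| <= kap t.
Proof.
apply: le_trans (gp_lip metd _ _ _) _.
by rewrite Minv_cat dist_Minv.
Qed.

(** Bounds the mean of one increment uniformly in the state, since [kappa <= wexp / a] and [wexp]
    has one-step mean at most [B]. *)
Definition step_bound := a^-1 * B.

Lemma step_bound_ge0 (x : E) : 0 <= step_bound.
Proof.
by rewrite mulr_ge0 ?invr_ge0 ?ltW//; apply: lt_le_trans (B_ge1 kerP w1 wB x).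
Qed.

Lemma kappa_wexp y : `|kappa o (X y)| <= a^-1 * wexp y.
Proof.
rewrite ger0_norm ?d0//; have := kap_weight [:: y].
by rewrite kap1 weight_cons /weight big_nil mulr1.
Qed.

Lemma step_kappa x : step P x (fun y => kappa o (X y)) <= step_bound.
Proof. exact: le_trans (ler_norm _) (step_abs kerP w1 wB x kappa_wexp). Qed.

(** * Mean displacement and mean Gromov product *)

Definition kap_mean n x := expect P n x kap.

Lemma kap_mean_ge0 n x : 0 <= kap_mean n x.
Proof. exact: (expect_ge0 kerP w1 wB n x dom_kap kap_ge0). Qed.

Lemma kap_mean1 x : kap_mean 1 x <= step_bound.
Proof.
by apply: le_trans (step_kappa x); rewrite /kap_mean /=; under eq_fun do rewrite kap1.
Qed.

Lemma expect_le_kap_mean n x F (c : R) : dom F -> (forall s, F s <= kap s + c) ->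
  expect P n x F <= kap_mean n x + c.
Proof.
move=> dF Fk; rewrite -[c in leRHS](expect_cst kerP w1 wB n x).
have dc : dom (fun=> c) by apply: (dominated_cst w1).
rewrite -(expect_add kerP w1 wB)//; last exact: dom_kap.
by apply: (expect_le kerP w1 wB) => //; apply: dominatedD dom_kap dc.
Qed.

Lemma dom_bounded (c : R) F : (forall s, `|F s| <= c) -> dom F.
Proof. by move=> Fc; apply: dominated_le (dominated_cst w1 c). Qed.

Lemma kap_mean_abs n : exists c, forall x, `|kap_mean n x| <= c.
Proof.
have [c kc] := dom_kap; exists (c * B ^+ n) => x.
exact: (expect_abs kerP w1 wB n x kc).
Qed.

Lemma dom_kap_mean n x : dom (fun s => kap_mean n (last x s)).
Proof. by have [c kc] := kap_mean_abs n; apply: (@dom_bounded c). Qed.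

Lemma kap_meanD n m x :
  kap_mean (n + m) x <= kap_mean n x + expect P n x (fun s => kap_mean m (last x s)).
Proof.
rewrite [leLHS]/kap_mean expectD -(expect_add kerP w1 wB); [|exact: dom_kap|exact: dom_kap_mean].
apply: (expect_le kerP w1 wB) => [||s].
- exact: (dominated_expect kerP w1 wB m x dom_kap).
- exact: dominatedD dom_kap (dom_kap_mean m x).
rewrite addrC; apply: expect_le_kap_mean => [|t]; first exact: (dominated_cat s dom_kap).
by rewrite addrC kap_cat.
Qed.

Lemma kap_mean_le n x : kap_mean n x <= n%:R * step_bound.
Proof.
elim: n x => [|n IH] x; first by rewrite /kap_mean /= /kap /= dxx mul0r.
rewrite -add1n; apply: le_trans (kap_meanD 1 n x) _; rewrite natrD mulrDl mul1r.
apply: lerD; first exact: kap_mean1.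
rewrite -[leRHS](expect_cst kerP w1 wB 1 x); apply: (expect_le kerP w1 wB) => //.
  exact: dom_kap_mean.
exact: (dominated_cst w1).
Qed.

(** Undoing the last [m] increments costs at most their mean displacement, so the mean is almost
    monotone in time. *)
Lemma kap_mean_prefix n m x : kap_mean n x <= kap_mean (n + m) x + m%:R * step_bound.
Proof.
rewrite [in leRHS]/kap_mean expectD.
have dk := dominated_expect kerP w1 wB m x dom_kap.
have dc : dom (fun=> m%:R * step_bound) by exact: (dominated_cst w1).
rewrite -[m%:R * step_bound](expect_cst kerP w1 wB n x) -(expect_add kerP w1 wB)//.
apply: (expect_le kerP w1 wB) => [||s]; [exact: dom_kap|exact: dominatedD|].
rewrite -lerBlDr; apply: le_trans (_ : kap s - kap_mean m (last x s) <= _).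
  by rewrite lerD2l lerN2 kap_mean_le.
rewrite -[kap s](expect_cst kerP w1 wB m (last x s)).
have dks : dom (fun=> kap s) by exact: (dominated_cst w1).
rewrite -(expect_sub kerP w1 wB) //; last exact: dom_kap.
apply: (expect_le kerP w1 wB) => [||t].
- by apply: dominatedD => //; rewrite (_ : (fun s => - kap s) = fun s => -1 * kap s);
    [exact: dominatedZ dom_kap|apply/funext => ?; rewrite mulN1r].
- exact: (dominated_cat s dom_kap).
by have := kap_prefix s t; lra.
Qed.

Definition gp_mean n x xi := expect P n x (gpM xi).

Lemma gp_mean_ge0 n x xi : 0 <= gp_mean n x xi.
Proof. exact: (expect_ge0 kerP w1 wB n x (dom_gpM xi) (gpM_ge0 xi)). Qed.

Lemma gp_mean_le n x xi : gp_mean n x xi <= n%:R * step_bound.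
Proof.
apply: le_trans (kap_mean_le n x).
exact: (expect_le kerP w1 wB n x (dom_gpM xi) dom_kap (gpM_le xi)).
Qed.

Lemma gp_mean_abs n x xi : `|gp_mean n x xi| <= n%:R * step_bound.
Proof. by rewrite ger0_norm ?gp_mean_ge0 ?gp_mean_le. Qed.

Lemma expect_dist n x F F' (c : R) K : dom F -> dom F' -> dom K ->
  (forall s, `|F s - F' s| <= K s) -> expect P n x K <= c ->
  `|expect P n x F - expect P n x F'| <= c.
Proof.
move=> dF dF' dK FGK Kc; apply: le_trans Kc.
have dFK := dominatedD dF dK; have dFK' := dominatedD dF' dK.
rewrite ler_norml; apply/andP; split.
  rewrite lerBrDr addrC lerBlDr -(expect_add kerP w1 wB)//.
  by apply: (expect_le kerP w1 wB) => // s; have := FGK s; rewrite ler_norml => /andP[]; lra.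
rewrite lerBlDr addrC -(expect_add kerP w1 wB)//.
by apply: (expect_le kerP w1 wB) => // s; have := FGK s; rewrite ler_norml => /andP[]; lra.
Qed.

Lemma gp_mean_step n x xi :
  `|gp_mean n.+1 x xi - step P x (fun y => gp_mean n y (act (X y) xi))| <= step_bound.
Proof.
(* Both terms become path functionals at horizon [1], so that [expect_dist] applies; the value [0]
   on the empty path only makes them total. *)
pose F s := if s is y :: _ then expect P n y (fun t => gpM xi (y :: t)) else 0.
pose F' s := if s is y :: _ then gp_mean n y (act (X y) xi) else 0.
pose K s := if s is y :: _ then kappa o (X y) else 0.
rewrite -[gp_mean n.+1 x xi]/(expect P 1 x F) -[step _ _ _]/(expect P 1 x F').
have Bx : 0 <= B by apply: le_trans (B_ge1 kerP w1 wB x).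
have wle z t : wexp z <= weight wexp (z :: t).
  by rewrite weight_cons; exact: ler_peMr (le_trans ler01 (w1 z)) (weight_ge1 w1 t).
apply: (@expect_dist _ _ _ _ _ K); last exact: step_kappa.
- have [c0 c0P] := dominated_step_arg kerP w1 wB n (dom_gpM xi).
  exists c0 => -[|z t] /=; rewrite ?normr0.
    exact: mulr_ge0 (bound_ge0 w1 x c0P) (le_trans ler01 (weight_ge1 w1 _)).
  apply: le_trans (c0P z) _; apply: ler_wpM2l; last exact: wle.
  exact: (bound_ge0 w1 x c0P).
- apply: (@dom_bounded (n%:R * step_bound)) => -[|z t] /=; last exact: gp_mean_abs.
  by rewrite normr0 mulr_ge0 ?ler0n// (step_bound_ge0 x).
- exists a^-1 => -[|z t] /=; rewrite ?normr0.
    by apply: mulr_ge0 (le_trans ler01 (weight_ge1 w1 _)); rewrite invr_ge0 ltW.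
  apply: le_trans (kappa_wexp z) _; apply: ler_wpM2l; last exact: wle.
  by rewrite invr_ge0 ltW.
move=> [|z t] /=; first by rewrite subrr normr0.
apply: (expect_dist (K := fun=> kappa o (X z))).
- exact: dominated_cons (dom_gpM xi).
- exact: dom_gpM.
- exact: (dominated_cst w1).
- by move=> s; exact: gpM_cons.
- by rewrite (expect_cst kerP w1 wB).
Qed.

Lemma gp_mean_succ n x xi : `|gp_mean n.+1 x xi - gp_mean n x xi| <= step_bound.
Proof.
rewrite -addn1 {1}/gp_mean expectD.
apply: (expect_dist (K := fun=> step_bound)); rewrite ?(expect_cst kerP w1 wB)//.
- exact: (dominated_expect kerP w1 wB 1 x (dom_gpM xi)).
- exact: dom_gpM.
- exact: (dominated_cst w1).
move=> s; rewrite -(expect_cst kerP w1 wB 1 (last x s) (gpM xi s)).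
apply: (expect_dist (K := kap)); last exact: kap_mean1.
- exact: (dominated_cat s (dom_gpM xi)).
- exact: (dominated_cst w1).
- exact: dom_kap.
- by move=> t; exact: gpM_cat.
Qed.

(** * Asymptotic rate of the Gromov product along an ultrafilter *)

Section UltraDrift.
Context (U : set_system nat) {UU : UltraFilter U}.
Hypothesis Uoo : \oo `<=` U.

Lemma U_ge N : U [set n | (N <= n)%N].
Proof. by apply: Uoo; exists N. Qed.

Lemma U_inv (c : R) : (fun n => c / n%:R) @ U --> (0 : R).
Proof.
apply/cvgrPdist_le => e e0.
apply: (filterS _ (U_ge (Num.truncn (`|c| / e)).+1)) => n /= nN.
have n0 : (0 : R) < n%:R by rewrite ltr0n; apply: leq_trans nN.
rewrite sub0r normrN normrM normfV (ger0_norm (ltW n0)) ler_pdivrMr// mulrC.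
rewrite -ler_pdivrMr//; apply: le_trans (ltW (truncnS_gt _)) _.
by rewrite ler_nat.
Qed.

Arguments U_inv : clear implicits.

Lemma ulim_le_err (u v : nat -> R) (c c1 : R) :
  (forall n, `|u n| <= c1) -> (forall n, `|v n| <= c1) ->
  (forall n, u n <= v n + c / n%:R) -> ulim U u <= ulim U v.
Proof.
move=> ub vb uv; rewrite -[leRHS]addr0.
have vc : (fun n => v n + c / n%:R) @ U --> ulim U v + 0.
  by apply: cvgD; [exact: ulim_cvg vb|exact: U_inv].
by apply: (ler_cvg_to (ulim_cvg ub) vc); apply: nearW.
Qed.

Definition gp_rate x xi := ulim U (fun n => gp_mean n x xi / n%:R).

Lemma gp_mean_div n x xi : 0 <= gp_mean n x xi / n%:R <= step_bound.
Proof.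
(* At [n = 0] the quotient is [0], because [0] is its own inverse by convention. *)
rewrite divr_ge0 ?gp_mean_ge0//=; case: n => [|n]; first by rewrite invr0 mulr0 (step_bound_ge0 x).
by rewrite ler_pdivrMr ?ltr0n// mulrC gp_mean_le.
Qed.

Lemma gp_mean_div_abs n x xi : `|gp_mean n x xi / n%:R| <= step_bound.
Proof. by have /andP[h1 h2] := gp_mean_div n x xi; rewrite ger0_norm. Qed.

Lemma gp_rate_cvg x xi : (fun n => gp_mean n x xi / n%:R) @ U --> gp_rate x xi.
Proof. by apply: (ulim_cvg (b := step_bound)) => n; exact: gp_mean_div_abs. Qed.

Arguments gp_rate_cvg : clear implicits.

Lemma gp_rate_ge0 x xi : 0 <= gp_rate x xi.
Proof.
apply: (cvgr_to_ge (gp_rate_cvg x xi)); apply: nearW => n.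
by have /andP[] := gp_mean_div n x xi.
Qed.

Lemma gp_rate_le x xi : gp_rate x xi <= step_bound.
Proof.
apply: (cvgr_to_le (gp_rate_cvg x xi)); apply: nearW => n.
by have /andP[] := gp_mean_div n x xi.
Qed.

Lemma gp_rate_abs x xi : `|gp_rate x xi| <= step_bound.
Proof. by rewrite ger0_norm ?gp_rate_ge0 ?gp_rate_le. Qed.

Lemma step_bound_wexp (x y : E) : step_bound <= step_bound * wexp y.
Proof. by apply: ler_peMr; [exact: step_bound_ge0 x|exact: w1]. Qed.

(* First-step analysis relates time [n.+1] to time [n]; since the means at these times
   differ by at most [step_bound], the ultralimit does not see the shift. *)
Lemma gp_rate_harmonic x xi : gp_rate x xi = step P x (fun y => gp_rate y (act (X y) xi)).
Proof.
have h1 : (fun n => step P x (fun y => gp_mean n y (act (X y) xi) / n%:R)) @ U -->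
    step P x (fun y => gp_rate y (act (X y) xi)).
  apply: (step_cvg kerP w1 wB (c := step_bound)) => [n y|y]; last exact: gp_rate_cvg.
  exact: le_trans (gp_mean_div_abs _ _ _) (step_bound_wexp x y).
apply: (cvg_unique _ _ h1) => //.
pose D n := step P x (fun y => gp_mean n y (act (X y) xi) / n%:R) - gp_mean n x xi / n%:R.
have D0 : D @ U --> (0 : R).
  (* One [step_bound] comes from first-step analysis, the other from the time shift. *)
  have lo := U_inv (- (2 * step_bound)); have hi := U_inv (2 * step_bound).
  apply: (squeeze_cvgr _ lo hi); apply: nearW => n.
  rewrite mulNr -ler_norml /D.
  have -> : step P x (fun y => gp_mean n y (act (X y) xi) / n%:R) =
      step P x (fun y => gp_mean n y (act (X y) xi)) / n%:R.
    have Gw y : `|gp_mean n y (act (X y) xi)| <= n%:R * step_bound * wexp y.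
      apply: le_trans (gp_mean_abs _ _ _) _.
      by rewrite -mulrA ler_wpM2l ?(step_bound_wexp x).
    rewrite mulrC -(stepZ kerP w1 wB x _ Gw).
    by congr step; apply/funext => y; rewrite mulrC.
  rewrite -mulrBl normrM [`|n%:R^-1|]ger0_norm ?invr_ge0//.
  apply: ler_wpM2r; first by rewrite invr_ge0.
  have := gp_mean_step n x xi; have := gp_mean_succ n x xi; rewrite !ler_norml.
  by move=> /andP[? ?] /andP[? ?]; apply/andP; split; lra.
have : (fun n => gp_mean n x xi / n%:R + D n) @ U --> gp_rate x xi + 0.
  by apply: cvgD D0; exact: gp_rate_cvg.
rewrite addr0.
by apply: cvg_trans; apply: near_eq_cvg; apply: nearW => n; rewrite /D /= addrC subrK.
Qed.

Lemma gp_rate_path m x xi : gp_rate x xi = expect P m x (fun s => gp_rate (last x s) (actM s xi)).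
Proof.
elim: m x xi => [//|m IH] x xi; rewrite gp_rate_harmonic /=; congr step.
by apply/funext => y; rewrite IH.
Qed.

(** The bounded error [c] disappears after division by [n]. *)
Lemma gp_rate_le_gp xi eta (c : R) x :
  (forall p, gp xi p <= gp eta p + c) -> gp_rate x xi <= gp_rate x eta.
Proof.
move=> h; apply: (ulim_le_err (c := c)) => [n|n|n].
- exact: gp_mean_div_abs.
- exact: gp_mean_div_abs.
rewrite -mulrDl; apply: ler_wpM2r; first by rewrite invr_ge0.
rewrite -[c](expect_cst kerP w1 wB n x) -(expect_add kerP w1 wB).
- apply: (expect_le kerP w1 wB) => [||s]; [exact: dom_gpM| |exact: h].
  by apply: dominatedD; [exact: dom_gpM|exact: (dominated_cst w1)].
- exact: dom_gpM.
- exact: (dominated_cst w1).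
Qed.

Lemma gp_rate_gt0_unbounded x xi : 0 < gp_rate x xi -> forall c : R, exists p, c <= gp xi p.
Proof.
move=> gpos c; apply: contrapT => /forallNP h; move: gpos; rewrite ltNge => /negP; apply.
have K0 (p : H) : gp xi p <= Num.max c 0.
  by rewrite le_max; apply/orP; left; rewrite leNgt; apply/negP => /ltW /h.
apply: (ler_cvg_to (gp_rate_cvg x xi) (U_inv (Num.max c 0))); apply: nearW => n.
apply: ler_wpM2r; first by rewrite invr_ge0.
rewrite -[leRHS](expect_cst kerP w1 wB n x).
apply: (expect_le kerP w1 wB) => [||s]; [exact: dom_gpM|exact: (dominated_cst w1)|exact: K0].
Qed.

(** * Hitting probabilities, positive paths, and sums of rates over distinct ends *)

Definition hit (z : E) (m : nat) (x : E) : R := expect P m x (fun s => (last x s == z)%:R).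

Lemma dom_hit z (x : E) : dom (fun s => (last x s == z)%:R).
Proof. by apply: (@dom_bounded 1) => s; case: eqP; rewrite ?normr1 ?normr0. Qed.

Lemma PnE m x z : Pn P m x z = (hit z m x)%:E.
Proof.
rewrite /Pn (ProbE kerP w1 wB); congr EFin; apply: eq_expect => s.
by case: eqP => h; [rewrite asboolT|rewrite asboolF].
Qed.

(* (A_1) makes [P^m] close to [pi] uniformly in the starting point, so a state of positive
   [pi]-mass is hit with uniformly positive probability; irreducibility carries this over
   to every state. *)
Lemma doeblin pi : irreducible P -> stationary_probability P pi -> cond_A1 P pi ->
  forall z, exists m (beta : R), [/\ (0 < m)%N, 0 < beta & forall x, beta <= hit z m x].
Proof.
move=> irr [pi0 pi1 _] [C [rho [C0 rho0 rho1 A1]]] z.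
have [y piy] : exists y, 0 < pi y.
  apply: contrapT => /forallNP h; have : \esum_(y in [set: E]) (pi y)%:E = 0%E.
    apply: esum1 => y _; have := h y; have := pi0 y.
    by rewrite le_eqVlt => /orP[/eqP <-|].
  by rewrite pi1 => /eqP; rewrite eqe oner_eq0.
have [m [m0 mP]] : exists m, (0 < m)%N /\ C * rho ^+ m <= pi y / 2.
  have : geometric C rho @ \oo --> 0 by apply: cvg_geometric; rewrite ger0_norm ?ltW.
  move/cvgrPdist_le => /(_ (pi y / 2)) []; first by lra.
  move=> N _ NP; exists N.+1; split => //; have := NP N.+1 (leqnSn N).
  by rewrite /= sub0r normrN; exact: le_trans (ler_norm _).
have hy x : pi y / 2 <= hit y m x.
  have : (`|Pn P m x y - (pi y)%:E| <= (C * rho ^+ m)%:E)%E.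
    apply: le_trans (A1 x m); apply: esum_ge; exists [set y].
      by split => //; exact: finite_set1.
    by rewrite fsbig_set1.
  by rewrite PnE /= lee_fin ler_norml => /andP[]; lra.
have [n] := irr y z; rewrite PnE lte_fin => qpos.
exists (m + n)%N, (hit z n y * (pi y / 2)); split.
- by rewrite addn_gt0 m0.
- by apply: mulr_gt0 => //; lra.
move=> x; rewrite {2}/hit expectD.
apply: le_trans (_ : hit z n y * hit y m x <= _).
  by apply: ler_wpM2l; [exact: ltW|exact: hy].
rewrite -(expect_scale kerP w1 wB _ _ _ (dom_hit y x)).
apply: (expect_le kerP w1 wB) => [||s].
- exact: dominatedZ (dom_hit y x).
- exact: (dominated_expect kerP w1 wB n x (dom_hit z x)).
under eq_expect do rewrite last_cat.
case: eqP => [->|_]; first by rewrite mulr1.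
by rewrite mulr0; apply: (expect_ge0 kerP w1 wB _ _ (dom_hit z _)) => t; case: eqP.
Qed.

Lemma pathprob_ge0 x s : 0 <= pathprob P x s.
Proof. by elim: s x => //= y s IH x; apply: mulr_ge0 (IH y); case: kerP. Qed.

(** Extracts from irreducibility a path of positive probability, along which families of ends will
    be transported. *)
Lemma exists_path : irreducible P -> forall x z, exists2 s, last x s = z & 0 < pathprob P x s.
Proof.
move=> irr x z; have [n] := irr x z; rewrite /Pn /Prob => pos.
apply: contrapT => h; move: pos; rewrite esum1 ?ltxx// => s /= sz; congr EFin.
apply/eqP; apply/negPn/negP => s0; apply: h; exists s => //.
by rewrite lt_def s0 pathprob_ge0.
Qed.

(* At any [p] all but at most one of the products [gp (f i) p] stay below a constant. *)
Lemma gp_sum_bounded k (f : nat -> horo) :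
  (forall i j, (i < j)%N -> (j < k)%N -> ~ same_end (f i) (f j)) ->
  exists C, forall p, \sum_(i < k) gp (f i) p <= d p o + C.
Proof.
elim: k => [|k IH] sep; first by exists 0 => p; rewrite big_ord0 addr0.
have [C CP] := IH (fun i j ij jk => sep i j ij (ltnW jk)).
have hK (i : 'I_k) : exists c : R, forall p, ~ (c <= gp (f i) p /\ c <= gp (f k) p).
  have := sep i k (ltn_ord i) (ltnSn k); apply: contra_notP => /forallNP h c.
  by have := h c; rewrite -existsNE => -[p /contrapT ?]; exists p.
have [c cP] := choice hK.
pose K := \sum_(i < k) `|c i|.
have cK i : c i <= K.
  apply: le_trans (ler_norm _) _; rewrite /K (bigD1 i)//= lerDl.
  by apply: sumr_ge0.
have K0 : 0 <= K by apply: sumr_ge0.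
(* If [gp (f k) p < K], the induction hypothesis bounds the other terms; otherwise each of the other
   [k] products is at most [K]. *)
exists (`|C| + K *+ k.+1) => p; rewrite big_ord_recr /=.
have KS : K <= K *+ k.+1 by rewrite mulrS lerDl mulrn_wge0.
have C1 : C <= `|C| := ler_norm C.
have [lt|ge] := ltP (gp (f k) p) K; first by have := CP p; lra.
have : \sum_(i < k) gp (f i) p <= \sum_(i < k) K.
  apply: ler_sum => i _; rewrite leNgt; apply/negP => lt; apply: (cP i p).
  by split; [apply: le_trans (ltW lt)|apply: le_trans ge].
rewrite sumr_const card_ord; have := gp_le (f k) p; rewrite mulrS.
by have := normr_ge0 C; lra.
Qed.

(** Average [gp_sum_bounded] over the walk and divide by [n]: the displacement contributes at most
    [step_bound], and [C / n] vanishes along [U]. *)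
Lemma sum_gp_rate_le k (f : nat -> horo) x :
  (forall i j, (i < j)%N -> (j < k)%N -> ~ same_end (f i) (f j)) ->
  \sum_(i < k) gp_rate x (f i) <= step_bound.
Proof.
move=> /gp_sum_bounded [C CP].
have h1 : (fun n => \sum_(i < k) (gp_mean n x (f i) / n%:R)) @ U --> \sum_(i < k) gp_rate x (f i).
  by apply: cvg_bigsum => i; exact: gp_rate_cvg.
have h2 : (fun n => step_bound + C / n%:R) @ U --> step_bound + 0.
  by apply: cvgD (U_inv C); exact: cvg_cst.
rewrite -[step_bound]addr0; apply: (ler_cvg_to h1 h2).
apply: (filterS _ (U_ge 1)) => n /= n1.
have n0 : (0 : R) < n%:R by rewrite ltr0n.
rewrite -mulr_suml ler_pdivrMr// mulrDl divfK ?gt_eqF//.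
rewrite -(expect_sum kerP w1 wB k n x (F := fun i => gpM (f i))); last first.
  by move=> i; exact: dom_gpM.
apply: le_trans (_ : kap_mean n x + C <= _); last first.
  by rewrite lerD2r mulrC kap_mean_le.
apply: expect_le_kap_mean => [|s]; last exact: CP.
elim: k {CP h1} => [|k IH].
  by under eq_fun do rewrite big_ord0; exact: (dominated_cst w1).
by under eq_fun do rewrite big_ord_recr; apply: dominatedD => //; exact: dom_gpM.
Qed.

Lemma same_end_actM s xi eta :
  same_end (actM s xi) (actM s eta) <-> same_end xi eta.
Proof. by elim: s xi eta => //= z s IH xi eta; rewrite IH same_end_act. Qed.

Lemma tends_to_actM u s xi : tends_to u xi ->
  tends_to (fun n => M_pt X s (u n)) (actM s xi).
Proof. by elim: s u xi => //= z s IH u xi h; apply: IH; exact: tends_to_act. Qed.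

(** * Vanishing of the rate for a non-elementary walk *)

Section NonElementary.
Variable delta : R.
Hypothesis hyp : forall w x y z,
  Num.min (gprod d w x y) (gprod d w y z) - delta <= gprod d w x z.
Hypothesis irr : irreducible P.
Hypothesis doe : forall z, exists m (beta : R),
  [/\ (0 < m)%N, 0 < beta & forall x, beta <= hit z m x].
Hypothesis nonel : non_elementary X P o.
Variable x0 : E.

Lemma same_end_gp_rate xi eta x : same_end xi eta -> gp_rate x xi = gp_rate x eta.
Proof.
move=> h; apply/eqP; rewrite eq_le; apply/andP; split; apply: (gp_rate_le_gp (c := 2 * delta)) => p.
  exact: (same_end_gp metd hyp).
by apply: (same_end_gp metd hyp); exact: same_end_sym.
Qed.

Definition gp_rates : set R := [set v | exists x xi, v = gp_rate x xi].
Definition gp_rate_max := sup gp_rates.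

Lemma gp_rates_sup : has_sup gp_rates.
Proof.
split; first by exists (gp_rate x0 (horo_pt o metd o)), x0, (horo_pt o metd o).
by exists step_bound => _ [x [xi ->]]; exact: gp_rate_le.
Qed.

Lemma gp_rate_le_max x xi : gp_rate x xi <= gp_rate_max.
Proof. by apply: (sup_upper_bound gp_rates_sup); exists x, xi. Qed.

(** If all rates at [z] were at most [gp_rate_max - e], harmonicity over [m] steps, which end at [z]
    with probability at least [beta], would lower every rate to [gp_rate_max - e * beta]. *)
Lemma gp_rate_near_max z e : 0 < e -> exists xi, gp_rate_max - e < gp_rate z xi.
Proof.
move=> e0; apply: contrapT => /forallNP h.
have h' xi : gp_rate z xi <= gp_rate_max - e by rewrite leNgt; apply/negP/h.
have [m [beta [_ beta0 hb]]] := doe z.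
have : gp_rate_max <= gp_rate_max - e * beta.
  apply: sup_le_ub => [|_ [x [xi ->]]]; first by case: gp_rates_sup.
  have dc : dom (fun=> gp_rate_max) by exact: (dominated_cst w1).
  have dh := dominatedZ (- e) (dom_hit z x).
  apply: le_trans (_ : gp_rate_max - e * hit z m x <= _); last first.
    by rewrite lerD2l lerN2; apply: ler_wpM2l => //; exact: ltW.
  rewrite (gp_rate_path m) -{1}(expect_cst kerP w1 wB m x gp_rate_max) -mulNr.
  rewrite -(expect_scale kerP w1 wB _ _ _ (dom_hit z x)) -(expect_add kerP w1 wB)//.
  apply: (expect_le kerP w1 wB) => [||s].
  - by apply: (@dom_bounded step_bound) => s; exact: gp_rate_abs.
  - exact: dominatedD.
  case: eqP => [->|_]; rewrite ?mulr1 ?mulr0 ?addr0; [exact: h'|exact: gp_rate_le_max].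
by have := mulr_gt0 e0 beta0; lra.
Qed.

(* Otherwise some end sequence has strictly increasing rates above [gp_rate_max / 2]; these
   ends are pairwise distinct and their rates add up without bound. *)
Lemma gp_rate_attains_max z : 0 < gp_rate_max -> exists xi, gp_rate z xi = gp_rate_max.
Proof.
move=> M0; apply: contrapT => /forallNP h.
have hlt xi : gp_rate z xi < gp_rate_max by rewrite lt_def eq_sym gp_rate_le_max andbT; apply/eqP/h.
have hnext xi : exists eta, Num.max (gp_rate z xi) (gp_rate_max / 2) < gp_rate z eta.
  pose m := Num.max (gp_rate z xi) (gp_rate_max / 2).
  have mM : m < gp_rate_max by rewrite /m gt_max hlt /=; lra.
  have [] := @gp_rate_near_max z (gp_rate_max - m); first by lra.
  by move=> eta; rewrite opprB addrC subrK; exists eta.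
have [next nextP] := choice hnext.
(* Starting at the first iterate puts every term above [gp_rate_max / 2]. *)
pose f k := iter k.+1 next (horo_pt o metd o).
have fS k : gp_rate z (f k) < gp_rate z (f k.+1).
  by have := nextP (f k); rewrite gt_max => /andP[].
have fM k : gp_rate_max / 2 < gp_rate z (f k).
  by have := nextP (iter k next (horo_pt o metd o)); rewrite gt_max => /andP[].
have fmono i j : (i < j)%N -> gp_rate z (f i) < gp_rate z (f j).
  elim: j => // j IH; rewrite ltnS leq_eqVlt => /orP[/eqP ->//|/IH].
  by move=> h1; apply: lt_trans h1 _.
(* Chosen so that [k] times [gp_rate_max / 2] exceeds [step_bound]. *)
pose k := (Num.truncn (step_bound / (gp_rate_max / 2))).+1.
have : \sum_(i < k) gp_rate z (f i) <= step_bound.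
  apply: sum_gp_rate_le => i j ij _ /(same_end_gp_rate z) e.
  by have := fmono i j ij; rewrite e ltxx.
have : \sum_(i < k) (gp_rate_max / 2) <= \sum_(i < k) gp_rate z (f i).
  by apply: ler_sum => i _; exact: ltW.
rewrite sumr_const card_ord -mulr_natl.
have : step_bound / (gp_rate_max / 2) < k%:R by exact: truncnS_gt.
by rewrite ltr_pdivrMr; lra.
Qed.

(** Maximum principle: by harmonicity the nonnegative defects
    [gp_rate_max - gp_rate z (act (X z) xi)] have mean zero, so none is positive at a state reached
    with positive probability. *)
Lemma gp_rate_max_act x xi y :
  0 < P x y -> gp_rate x xi = gp_rate_max -> gp_rate y (act (X y) xi) = gp_rate_max.
Proof.
move=> Pxy gM; apply/eqP; rewrite eq_le gp_rate_le_max /= leNgt; apply/negP => lt.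
have bw1 z : `|gp_rate z (act (X z) xi)| <= step_bound * wexp z.
  by apply: le_trans (step_bound_wexp x z); exact: gp_rate_abs.
have bw2 (z : E) : `|gp_rate_max| <= `|gp_rate_max| * wexp z.
  by apply: ler_peMr; [exact: normr_ge0|exact: w1].
have sb : step P x (fun z => gp_rate_max + -1 * gp_rate z (act (X z) xi)) = 0.
  have bw3 z : `|-1 * gp_rate z (act (X z) xi)| <= step_bound * wexp z by rewrite mulN1r normrN.
  rewrite (stepD kerP w1 wB x bw2 bw3) (stepZ kerP w1 wB x _ bw1) -gp_rate_harmonic gM.
  by rewrite (step_cst kerP w1 wB) mulN1r subrr.
have bw4 z : 0 <= gp_rate_max + -1 * gp_rate z (act (X z) xi) <=
    (`|gp_rate_max| + step_bound) * wexp z.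
  have := bw1 z; have := bw2 z; rewrite mulrDl ler_norml => /andP[? ?].
  by rewrite ler_norml => /andP[? ?]; have := gp_rate_le_max z (act (X z) xi); lra.
have := step_ge1 kerP w1 wB x y bw4; rewrite sb.
by rewrite pmulr_rle0//; lra.
Qed.

Lemma gp_rate_max_actM x s xi : 0 < pathprob P x s -> gp_rate x xi = gp_rate_max ->
  gp_rate (last x s) (actM s xi) = gp_rate_max.
Proof.
elim: s x xi => //= y s IH x xi pp gM.
have P0 : 0 <= P x y by case: kerP.
have Pxy : 0 < P x y.
  by rewrite lt_def P0 andbT; apply/eqP => e; move: pp; rewrite e mul0r ltxx.
by apply: IH; [rewrite -(pmulr_rgt0 _ Pxy)|exact: (gp_rate_max_act Pxy)].
Qed.

(** Indexing by [nat], with only the entries below [k] constrained, makes it easy to append an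
    end. *)
Definition max_family k x (f : nat -> horo) :=
  (forall i, (i < k)%N -> gp_rate x (f i) = gp_rate_max) /\
  (forall i j, (i < j)%N -> (j < k)%N -> ~ same_end (f i) (f j)).

Lemma max_family_actM k x f s : 0 < pathprob P x s -> max_family k x f ->
  max_family k (last x s) (fun i => actM s (f i)).
Proof.
move=> pp [f1 f2]; split => [i ik|i j ij jk]; first by apply: gp_rate_max_actM => //; exact: f1.
by rewrite same_end_actM; exact: f2.
Qed.

(* A family of maximal cardinality at one state is transported to every other state, hence
   is maximal everywhere, and an injection between such families is onto. *)
Lemma gp_rate_max_le0 : gp_rate_max <= 0.
Proof.
rewrite leNgt; apply/negP => M0.
have fam_bound k : (exists f, max_family k x0 f) ->
    (k <= (Num.truncn (step_bound / gp_rate_max)))%N.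
  move=> [f [f1 f2]]; have := sum_gp_rate_le x0 f2.
  rewrite (eq_bigr (fun=> gp_rate_max)); last by move=> i _; exact: f1.
  rewrite sumr_const card_ord -mulr_natl -ler_pdivlMr// => kb.
  by rewrite truncn_ge_nat// (le_trans _ kb).
have fam1 : exists k, `[< exists f, max_family k x0 f >].
  exists 0%N; apply/asboolP; exists (fun=> horo_pt o metd o).
  by split => [i|i j _]; rewrite ltn0.
have fam_ub k : `[< exists f, max_family k x0 f >] ->
    (k <= (Num.truncn (step_bound / gp_rate_max)))%N.
  by move=> /asboolP; exact: fam_bound.
have [K /asboolP [f0 f0P] Kmax] := ex_maxnP fam1 fam_ub.
have famK x : exists f, max_family K x f.
  by have [s <- pp] := exists_path irr x0 x; eexists; exact: max_family_actM pp f0P.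
have famS x : ~ exists f, max_family K.+1 x f.
  move=> [f fP]; have [s e pp] := exists_path irr x x0.
  have : (K.+1 <= K)%N.
    by apply: Kmax; apply/asboolP; rewrite -e; eexists; exact: max_family_actM pp fP.
  by rewrite ltnn.
have [f fP] := choice famK.
(* Otherwise [xi] could be appended to the family at [x], contradicting the maximality of [K]. *)
have fmax x xi : gp_rate x xi = gp_rate_max -> exists i : 'I_K, same_end xi (f x i).
  move=> gM; apply: contrapT => /forallNP h; apply: (famS x).
  exists (fun i => if (i < K)%N then f x i else xi); split => [i|i j ij].
    by rewrite ltnS => iK; case: ifP => // lt; apply: (fP x).1.
  rewrite ltnS leq_eqVlt => /orP[/eqP jK|jK].
    rewrite jK in ij *; rewrite ltnn ij => se.
    by apply: (h (Ordinal ij)); exact: same_end_sym.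
  by rewrite jK (ltn_trans ij jK); apply: (fP x).2.
(* A positive rate forces an unbounded product, so each end is represented by a sequence; these
   sequences form the forbidden maps [V]. *)
have unb x (i : 'I_K) : exists u, tends_to u (f x i).
  apply: unbounded_tends_to; apply: (gp_rate_gt0_unbounded (x := x)).
  by rewrite (fP x).1.
have [V0 V0P] := choice (fun xi : E * 'I_K => unb xi.1 xi.2).
pose V (i : 'I_K) x := V0 (x, i).
have VP x i : tends_to (V i x) (f x i) by exact: (V0P (x, i)).
apply: nonel; exists K, V; split.
- rewrite lt0n; apply/eqP => K0; have [xi xiM] := gp_rate_attains_max x0 M0.
  by have [i _] := fmax x0 xi xiM; have := ltn_ord i; rewrite {2}K0 ltn0.
- by move=> i x; exact: (tends_to_conv_infty metd hyp (VP x i)).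
(* The exceptional event is null because every path of positive probability carries the maximal ends
   at [z] bijectively onto those at its last state. *)
move=> z n; rewrite /Prob; apply: esum1 => t /= bad; congr EFin.
apply/eqP; apply/negPn/negP => t0; apply: bad.
have pp : 0 < pathprob P z t by rewrite lt_def t0 pathprob_ge0.
move: (val t) pp => s pp {t0 t}.
have ij (i : 'I_K) : exists j : 'I_K, same_end (actM s (f z i)) (f (last z s) j).
  by apply: fmax; exact: (gp_rate_max_actM pp ((fP z).1 i (ltn_ord i))).
have eqv (i j : 'I_K) : same_end (actM s (f z i)) (f (last z s) j) ->
    bd_equiv d o (fun m => M_pt X s (V i z m)) (V j (last z s)).
  move=> se; apply: (tends_to_bd_equiv metd hyp (xi := f (last z s) j)); last exact: VP.
  apply: (tends_to_same_end metd hyp se); apply: tends_to_actM; exact: VP.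
split => [i|j]; first by have [j jP] := ij i; exists j; exact: eqv.
have [phi phiP] := choice ij.
have phi_inj : injective phi.
  move=> i i' e; have se : same_end (f z i) (f z i').
    rewrite -(same_end_actM s); apply: (same_end_trans metd hyp (phiP i)).
    by rewrite e; apply: same_end_sym; exact: phiP.
  apply/val_inj; case: (ltngtP i i') => // lt.
    by case: ((fP z).2 i i' lt (ltn_ord i')).
  by case: ((fP z).2 i' i lt (ltn_ord i)); exact: same_end_sym.
have [psi _ psiK] := injF_bij phi_inj.
by exists (psi j); apply: eqv; rewrite -{2}(psiK j).
Qed.

Lemma gp_rate_eq0 x xi : gp_rate x xi = 0.
Proof.
by apply/eqP; rewrite eq_le gp_rate_ge0 andbT (le_trans (gp_rate_le_max x xi) gp_rate_max_le0).
Qed.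

(** * Mean of the cocycle and its comparison with the drift *)

Definition sigma_mean n x xi := expect P n x (fun s => sigmaM X o s (sval xi)).

Lemma sigma_mean_kap n x xi : sigma_mean n x xi = kap_mean n x - 2 * gp_mean n x xi.
Proof.
rewrite /sigma_mean; under eq_expect do rewrite gp_sigma.
rewrite (expect_sub kerP w1 wB); [|exact: dom_kap|exact: dominatedZ (dom_gpM xi)].
by rewrite (expect_scale kerP w1 wB)//; exact: dom_gpM.
Qed.

Lemma sigma_mean_abs n x xi : `|sigma_mean n x xi| <= n%:R * step_bound.
Proof.
have := kap_mean_le n x; have := kap_mean_ge0 n x; have := gp_mean_ge0 n x xi.
have : gp_mean n x xi <= kap_mean n x.
  exact: (expect_le kerP w1 wB n x (dom_gpM xi) dom_kap (gpM_le xi)).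
by rewrite sigma_mean_kap ler_norml => ? ? ? ?; apply/andP; split; lra.
Qed.

Lemma dom_sigma_mean m x xi : dom (fun s => sigma_mean m (last x s) (actM s xi)).
Proof. by apply: (@dom_bounded (m%:R * step_bound)) => s; exact: sigma_mean_abs. Qed.

Lemma sigma_meanD n m x xi : sigma_mean (n + m) x xi =
  sigma_mean n x xi + expect P n x (fun s => sigma_mean m (last x s) (actM s xi)).
Proof.
rewrite /sigma_mean expectD -(expect_add kerP w1 wB); [|exact: dom_sigma|exact: dom_sigma_mean].
apply: eq_expect => s; rewrite -[in RHS](expect_cst kerP w1 wB m (last x s) (sigmaM _ _ s _)).
rewrite -(expect_add kerP w1 wB); [|exact: (dominated_cst w1)|exact: dom_sigma].
by apply: eq_expect => t; rewrite sigma_cat.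
Qed.

Lemma expect_ge_hit z n x F (A e : R) : dom F ->
  (forall s, A + e * (last x s == z)%:R <= F s) -> A + e * hit z n x <= expect P n x F.
Proof.
move=> dF h; have dc : dom (fun=> A) by exact: (dominated_cst w1).
have dh := dominatedZ e (dom_hit z x).
rewrite -{1}(expect_cst kerP w1 wB n x A).
rewrite -(expect_scale kerP w1 wB _ _ _ (dom_hit z x)) -(expect_add kerP w1 wB)//.
by apply: (expect_le kerP w1 wB) => //; exact: dominatedD.
Qed.

Definition kap_mean_sup n : R := sup [set v | exists x, v = kap_mean n x].
Definition drift : R := inf [set v | exists n, (0 < n)%N /\ v = kap_mean_sup n / n%:R].

Lemma kap_mean_sup_has n : has_sup [set v | exists x, v = kap_mean n x].
Proof.
split; first by exists (kap_mean n x0), x0.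
by exists (n%:R * step_bound) => _ [x ->]; exact: kap_mean_le.
Qed.

Lemma kap_mean_le_sup n x : kap_mean n x <= kap_mean_sup n.
Proof. by apply: (sup_upper_bound (kap_mean_sup_has n)); exists x. Qed.

Lemma kap_mean_sup_ge0 n : 0 <= kap_mean_sup n.
Proof. exact: le_trans (kap_mean_ge0 n x0) (kap_mean_le_sup n x0). Qed.

Lemma drift_has : has_inf [set v | exists n, (0 < n)%N /\ v = kap_mean_sup n / n%:R].
Proof.
split; first by exists (kap_mean_sup 1 / 1%:R), 1%N.
by exists 0 => _ [n [_ ->]]; rewrite divr_ge0// kap_mean_sup_ge0.
Qed.

Lemma drift_ge0 : 0 <= drift.
Proof.
apply: lb_le_inf => [|_ [n [_ ->]]]; first by case: drift_has.
by rewrite divr_ge0// kap_mean_sup_ge0.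
Qed.

Lemma drift_le n : n%:R * drift <= kap_mean_sup n.
Proof.
case: n => [|n]; first by rewrite mul0r kap_mean_sup_ge0.
rewrite mulrC -ler_pdivlMr ?ltr0n//; apply: ge_inf; first by case: drift_has.
by exists n.+1.
Qed.

Lemma kap_mean_upper e : 0 < e ->
  exists n, (0 < n)%N /\ forall x, kap_mean n x <= n%:R * (drift + e).
Proof.
move=> e0; have [_ [n [n0 ->]] lt] := inf_adherent e0 drift_has.
exists n; split => // x; apply: le_trans (kap_mean_le_sup n x) _.
by rewrite mulrC -ler_pdivrMr ?ltr0n// ltW.
Qed.

(** From any [x] the walk is at [z] after [m] steps with probability at least [beta]. Thus a mean at
    [z] far below the supremum would pull all means below it; comparing suprema gives a gap at most
    [2 * m * step_bound / beta], while the supremum is at least [n * drift]. *)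
Lemma kap_mean_lower z : exists c, forall n, n%:R * drift - c <= kap_mean n z.
Proof.
have [m [beta [_ beta0 hb]]] := doe z.
exists (2 * (m%:R * step_bound) / beta) => n.
have key x : kap_mean n x <=
    2 * (m%:R * step_bound) + kap_mean_sup n - (kap_mean_sup n - kap_mean n z) * beta.
  apply: le_trans (kap_mean_prefix n m x) _; rewrite addnC.
  have := kap_meanD m n x; have := kap_mean_le m x.
  have : - kap_mean_sup n + (kap_mean_sup n - kap_mean n z) * hit z m x <=
      expect P m x (fun s => -1 * kap_mean n (last x s)).
    apply: expect_ge_hit => [|s]; first exact: dominatedZ (dom_kap_mean n x).
    by case: eqP => [->|_]; rewrite ?mulr1 ?mulr0 mulN1r; [lra|rewrite addr0 lerN2 kap_mean_le_sup].
  rewrite (expect_scale kerP w1 wB _ _ _ (dom_kap_mean n x)).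
  have : (kap_mean_sup n - kap_mean n z) * beta <= (kap_mean_sup n - kap_mean n z) * hit z m x.
    by apply: ler_wpM2l; [rewrite subr_ge0 kap_mean_le_sup|exact: hb].
  lra.
have : kap_mean_sup n <=
    2 * (m%:R * step_bound) + kap_mean_sup n - (kap_mean_sup n - kap_mean n z) * beta.
  by apply: sup_le_ub => [|_ [x ->]]; [case: (kap_mean_sup_has n)|exact: key].
have := drift_le n => h1 h2.
have : kap_mean_sup n - kap_mean n z <= 2 * (m%:R * step_bound) / beta.
  by rewrite ler_pdivlMr//; lra.
lra.
Qed.

Lemma sigma_mean_pointwise z xi e (D : R) : 0 < e ->
  exists n, (0 < n)%N /\ n%:R * (drift - e) + D <= sigma_mean n z xi.
Proof.
move=> e0; have [c cP] := kap_mean_lower z.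
(* The term [2 * gp_mean] then costs at most [n * e / 2], and the remaining [n * e / 2] absorbs
   [c + D]. *)
have e4 : 0 < e / 4 by lra.
have near1 : U [set n | `|0 - gp_mean n z xi / n%:R| <= e / 4].
  have gc := gp_rate_cvg z xi; rewrite gp_rate_eq0 in gc.
  by move/cvgrPdist_le : gc => /(_ _ e4).
have near2 := U_ge (Num.truncn (Num.max 0 (c + D) / (e / 2))).+1.
have [n [/= n1 n2]] := filter_ex (filterI near1 near2).
have n0 : (0 < n)%N by apply: leq_trans n2.
have n0R : (0 : R) < n%:R by rewrite ltr0n.
exists n; split => //; rewrite sigma_mean_kap.
move: n1; rewrite sub0r normrN ler_norml => /andP[_]; rewrite ler_pdivrMr// => n1.
have : Num.max 0 (c + D) / (e / 2) <= n%:R.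
  by apply: le_trans (ltW (truncnS_gt _)) _; rewrite ler_nat.
rewrite ler_pdivrMr; last by lra.
have : c + D <= Num.max 0 (c + D) by rewrite le_max lexx orbT.
by have := cP n; lra.
Qed.

(** Counterexamples for every [N] would have an ultralimit [xi]; at the time that
    [sigma_mean_pointwise] gives for it, continuity of the mean yields a contradiction. *)
Lemma sigma_mean_compact z e (D : R) : 0 < e -> exists N, forall xi,
  exists n, [/\ (0 < n)%N, (n <= N)%N & n%:R * (drift - e) + D <= sigma_mean n z xi].
Proof.
move=> e0; apply: contrapT => /forallNP h.
have h' N : exists xi, forall n, (0 < n)%N -> (n <= N)%N ->
    sigma_mean n z xi <= n%:R * (drift - e) + D.
  have := h N; move=> /existsNP [xi /forallNP xiP]; exists xi => n n0 nN.
  by rewrite leNgt; apply/negP => /ltW lt; apply: (xiP n).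
have [xi_ xi_P] := choice h'.
have [xi xiP] := horo_ulim (U := U) xi_.
(* The surplus [D + 1] keeps a gap after the strict inequalities degrade in the limit. *)
have [n [n0 nP]] := sigma_mean_pointwise z xi (D + 1) e0.
have : (fun k => sigma_mean n z (xi_ k)) @ U --> sigma_mean n z xi.
  apply: (expect_cvg kerP w1 wB (c := a^-1)) => [k s|s]; last exact: xiP.
  by apply: le_trans (kap_weight s); exact: sigma_le.
move=> cv; have : sigma_mean n z xi <= n%:R * (drift - e) + D.
  apply: (cvgr_to_le cv); apply: (filterS _ (U_ge n)) => k /= nk.
  exact: xi_P.
lra.
Qed.

Lemma sigma_mean_lower e : 0 < e ->
  exists n, (0 < n)%N /\ forall x xi, n%:R * (drift - e) <= sigma_mean n x xi.
Proof.
move=> e0; have e2 : 0 < e / 2 by lra.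
pose z := x0; have [m [beta [m0 beta0 hb]]] := doe z.
pose L := drift - e / 2; have b0 := step_bound_ge0 x0.
have bL0 : 0 <= step_bound + `|L| by rewrite addr_ge0.
pose D := m%:R * (step_bound + `|L|) / beta.
have D0 : 0 <= D by apply: divr_ge0; [exact: mulr_ge0|exact: ltW].
have [N NP] := sigma_mean_compact z D e2.
(* [K] covers horizons below [N + m], which may be too short for a block. *)
pose K := (N + m)%:R * (step_bound + `|L|).
have K0 : 0 <= K by rewrite mulr_ge0.
have LL : L <= `|L| := ler_norm L.
(* The deficit [D] at states other than [z] pays for the [m] steps spent reaching [z], and
   is recovered by the surplus [D] of the blocks started at [z]. *)
have claim T x xi : T%:R * L - K - D + D * (x == z)%:R <= sigma_mean T x xi.
  elim/ltn_ind: T x xi => T IH x xi.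
  have [TS|TL] := ltnP T (N + m).
    have : T%:R * (step_bound + L) <= K.
      apply: (@le_trans _ _ (T%:R * (step_bound + `|L|))); first by apply: ler_wpM2l => //; lra.
      by apply: ler_wpM2r => //; rewrite ler_nat ltnW.
    have := sigma_mean_abs T x xi; rewrite ler_norml => /andP[h1 _].
    have : D * (x == z)%:R <= D by case: eqP => _; rewrite ?mulr1 ?mulr0.
    by lra.
  case: eqP => [->|_]; rewrite ?mulr1 ?mulr0.
    have [n [n0 nN nP]] := NP xi.
    have nT : (n <= T)%N by apply: leq_trans nN _; apply: leq_trans TL; exact: leq_addr.
    rewrite -(subnKC nT) sigma_meanD natrD.
    have : (T - n)%:R * L - K - D + 0 * hit z n z <=
        expect P n z (fun s => sigma_mean (T - n) (last z s) (actM s xi)).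
      apply: expect_ge_hit => [|s]; first exact: dom_sigma_mean.
      rewrite mul0r addr0; apply: le_trans (IH _ _ _ _).
        by rewrite lerDl mulr_ge0.
      by rewrite ltn_subrL n0 (leq_trans n0).
    by rewrite /L in nP *; lra.
  have mT : (m <= T)%N by apply: leq_trans TL; exact: leq_addl.
  rewrite -(subnKC mT) sigma_meanD natrD.
  have : (T - m)%:R * L - K - D + D * hit z m x <=
      expect P m x (fun s => sigma_mean (T - m) (last x s) (actM s xi)).
    apply: expect_ge_hit => [|s]; first exact: dom_sigma_mean.
    by apply: IH; rewrite ltn_subrL m0 (leq_trans m0).
  have := sigma_mean_abs m x xi; rewrite ler_norml => /andP[h1 _].
  have : D * beta <= D * hit z m x by apply: ler_wpM2l.
  have : D * beta = m%:R * (step_bound + `|L|) by rewrite divfK// gt_eqF.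
  have : m%:R * (step_bound + L) <= m%:R * (step_bound + `|L|) by apply: ler_wpM2l => //; lra.
  lra.
(* Long enough for the second half of [e] to absorb [K + D]. *)
pose n := (Num.truncn ((K + D) / (e / 2))).+1.
exists n; split => // x xi; apply: le_trans (claim n x xi).
have : (K + D) / (e / 2) <= n%:R by exact: ltW (truncnS_gt _).
rewrite ler_pdivrMr// /L => h.
have : 0 <= D * (x == z)%:R by rewrite mulr_ge0.
lra.
Qed.

Lemma sigma_mean_upper e : 0 < e ->
  exists n, (0 < n)%N /\ forall x xi, sigma_mean n x xi <= n%:R * (drift + e).
Proof.
move=> /kap_mean_upper [n [n0 nP]]; exists n; split => // x xi.
by rewrite sigma_mean_kap; have := gp_mean_ge0 n x xi; have := nP x; lra.
Qed.

End NonElementary.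

End UltraDrift.

(** * Exponential moments and one-sided deviation bounds *)

(** The inequality [1 + v <= expR v] at [v = u] and [v = - u] suffices, with the sign of [u]
    deciding how the two are combined. *)
Lemma expR_taylor2 (u : R) : expR u <= 1 + u + u ^+ 2 * expR `|u|.
Proof.
have h1 := expR_ge1Dx u; have h2 := expR_ge1Dx (- u).
have hm : expR (- u) * expR u = 1 by rewrite -expRD addNr expR0.
have e0 : 0 < expR u := expR_gt0 u.
have h3 : (1 - u) * expR u <= 1 by rewrite -[leRHS]hm; apply: ler_wpM2r => //; exact: ltW.
have [u0|u0] := leP 0 u.
  rewrite ger0_norm//.
  have : u * (expR u - 1) <= u * (u * expR u) by apply: ler_wpM2l => //; lra.
  by rewrite expr2; lra.
have h4 : u ^+ 2 <= u ^+ 2 * expR `|u|.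
  apply: ler_peMr; first exact: sqr_ge0.
  by rewrite -expR0 ler_expR.
have : u * (expR u - 1) <= u * u by apply: ler_wnM2l; [exact: ltW|lra].
by rewrite -expr2; lra.
Qed.

Lemma sqr_le_expR (c z : R) : 0 < c -> z ^+ 2 <= (4 / c ^+ 2) * expR (c * `|z|).
Proof.
move=> c0; have h : c / 2 * `|z| <= expR (c / 2 * `|z|).
  by apply: le_trans (expR_ge1Dx _); lra.
have : (c / 2 * `|z|) ^+ 2 <= expR (c * `|z|).
  rewrite (_ : c * `|z| = c / 2 * `|z| + c / 2 * `|z|); last by field.
  rewrite expRD -expr2 lerXn2r// ?nnegrE ?expR_ge0//.
  by rewrite mulr_ge0// divr_ge0// ltW.
rewrite exprMn real_normK ?num_real// => h2.
rewrite -ler_pdivrMl; last by rewrite divr_gt0// exprn_gt0.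
apply: le_trans h2; rewrite le_eqVlt; apply/orP; left; apply/eqP.
by field; rewrite gt_eqF.
Qed.

(** The sign [tau] treats both tails at once. The expansion bounds the moment by
    [1 - t * n * e + t ^+ 2 * C' * B ^+ n], which is at most [1] for small [t]. *)
Lemma exp_moment_le1 (tau c e : R) n : `|tau| = 1 -> 0 < e -> (0 < n)%N ->
  (forall x xi, tau * sigma_mean n x xi <= n%:R * (c - e)) ->
  exists t : R, [/\ 0 < t, t <= a & forall x xi,
    expect P n x (fun s => expR (t * (tau * sigmaM X o s (sval xi) - n%:R * c))) <= 1].
Proof.
move=> tau1 e0 n0 drift.
pose A := n%:R * `|c|; pose C' := 4 / (a / 2) ^+ 2 * expR (a * A).
have C'0 : 0 < C' by rewrite mulr_gt0 ?expR_gt0// divr_gt0// exprn_gt0// divr_gt0.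
pose C2 := C' * `|B| ^+ n + 1.
have C20 : 0 < C2 by apply: ltr_pwDr => //; apply: mulr_ge0; [exact: ltW|exact: exprn_ge0].
have n0R : (0 : R) < n%:R by rewrite ltr0n.
(* Of the exponential rate [a], one half is for [t] and the other dominates the square; the second
   bound gives [t * C2 <= n * e]. *)
pose t := Num.min (a / 2) (n%:R * e / C2).
have t0 : 0 < t by rewrite lt_min !divr_gt0// mulr_gt0.
have ta : t <= a / 2 by rewrite ge_min lexx.
have te : t <= n%:R * e / C2 by rewrite ge_min lexx orbT.
exists t; split => //; first by apply: le_trans ta _; rewrite ler_pdivrMr// ler_pMr// ler1n.
move=> x xi; pose Z s := tau * sigmaM X o s (sval xi) - n%:R * c.
have ZA s : `|Z s| <= kap s + A.
  apply: le_trans (ler_normB _ _) _; rewrite !normrM tau1 mul1r normr_nat.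
  by rewrite lerD2r; exact: sigma_le.
have pt s : expR (t * Z s) <= 1 + t * Z s + t ^+ 2 * C' * weight wexp s.
  apply: le_trans (expR_taylor2 _) _; rewrite lerD2l exprMn -[leLHS]mulrA -[leRHS]mulrA.
  apply: ler_wpM2l; first exact: sqr_ge0.
  apply: (@le_trans _ _ (4 / (a / 2) ^+ 2 * expR (a / 2 * `|Z s|) * expR (a / 2 * `|Z s|))).
    apply: ler_pM; rewrite ?sqr_ge0 ?expR_ge0//.
      by apply: sqr_le_expR; rewrite divr_gt0.
    by rewrite ler_expR normrM (ger0_norm (ltW t0)); apply: ler_wpM2r.
  rewrite -!mulrA; do 2! (apply: ler_wpM2l; first by rewrite ?invr_ge0 ?sqr_ge0).
  rewrite -expRD (_ : _ + _ = a * `|Z s|); last by field.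
  apply: le_trans (_ : expR (a * A) * expR (a * kap s) <= _).
    rewrite -expRD ler_expR -mulrDr; apply: ler_wpM2l; first exact: ltW.
    by rewrite addrC.
  by apply: ler_wpM2l; [exact: expR_ge0|exact: expR_kap].
have dZ : dom Z.
  apply: dominatedD; first exact: dominatedZ (dom_sigma xi).
  exact: (dominated_cst w1).
have dw : dom (fun s => t ^+ 2 * C' * weight wexp s).
  exists `|t ^+ 2 * C'| => s; rewrite normrM [`|weight _ _|]ger0_norm//.
  exact: le_trans (weight_ge1 w1 s).
have d1 : dom (fun s => 1 + t * Z s).
  by apply: dominatedD; [exact: (dominated_cst w1)|exact: dominatedZ].
have dr := dominatedD d1 dw.
have de : dom (fun s => expR (t * Z s)).
  by apply: dominated_le dr => s; rewrite ger0_norm ?expR_ge0.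
apply: le_trans (expect_le kerP w1 wB n x de dr pt) _.
rewrite (expect_add kerP w1 wB)// (expect_add kerP w1 wB); last 2 first.
- exact: (dominated_cst w1).
- exact: dominatedZ.
rewrite (expect_cst kerP w1 wB) (expect_scale kerP w1 wB)//.
have EZ : expect P n x Z <= - (n%:R * e).
  rewrite /Z (expect_sub kerP w1 wB); last 2 first.
  - exact: dominatedZ (dom_sigma xi).
  - exact: (dominated_cst w1).
  rewrite (expect_scale kerP w1 wB); last exact: dom_sigma.
  by rewrite (expect_cst kerP w1 wB); have := drift x xi; rewrite /sigma_mean; lra.
have Ew : expect P n x (fun s => t ^+ 2 * C' * weight wexp s) <= t ^+ 2 * C' * `|B| ^+ n.
  rewrite [X in _ <= _ * X ^+ _]ger0_norm; last exact: le_trans ler01 (B_ge1 kerP w1 wB x).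
  apply: le_trans (ler_norm _) _; apply: (expect_abs kerP w1 wB) => s.
  rewrite ger0_norm// mulr_ge0 ?(le_trans ler01 (weight_ge1 w1 s))//.
  by rewrite mulr_ge0 ?sqr_ge0// ltW.
have : t * expect P n x Z <= t * - (n%:R * e) by apply: ler_wpM2l => //; exact: ltW.
have : t ^+ 2 * C' * `|B| ^+ n <= t * (n%:R * e).
  apply: (@le_trans _ _ (t * (t * C2))).
    have -> : t ^+ 2 * C' * `|B| ^+ n = t * (t * (C' * `|B| ^+ n)) by ring.
    do 2! (apply: ler_wpM2l; first exact: ltW).
    by rewrite /C2 lerDl.
  by apply: ler_wpM2l; [exact: ltW|rewrite -ler_pdivlMr].
lra.
Qed.

(** Peeling off initial blocks of length [n0], each with moment at most [1], bounds the exponential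
    moments uniformly in time. A Chernoff bound then gives the decay. *)
Lemma large_deviation (tau c e : R) n0 : `|tau| = 1 -> 0 < e -> (0 < n0)%N ->
  (forall x xi, tau * sigma_mean n0 x xi <= n0%:R * (c - e)) ->
  exists alpha C : R, [/\ 0 < alpha, 0 < C & forall x xi n,
    expect P n x (fun s => (n%:R * c <= tau * sigmaM X o s (sval xi))%R%:R)
      <= C * expR (- (alpha * n%:R))].
Proof.
move=> tau1 e0 n00 drift; have e2 : 0 < e / 2 by lra.
(* Half of the gap makes the block moment at most [1]; the other half becomes the decay rate
   [t * (e / 2)]. *)
pose c' := c - e / 2.
have drift' x xi : tau * sigma_mean n0 x xi <= n0%:R * (c' - e / 2).
  by apply: le_trans (drift x xi) _; rewrite /c' -addrA -opprD -splitr.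
have [t [t0 ta tP]] := exp_moment_le1 tau1 e2 n00 drift'.
pose Y T xi s := expR (t * (tau * sigmaM X o s (sval xi) - T%:R * c')).
have Y0 T xi s : 0 < Y T xi s by exact: expR_gt0.
have Yw T xi s : `|Y T xi s| <= expR (t * (T%:R * `|c'|)) * weight wexp s.
  rewrite ger0_norm ?(ltW (Y0 _ _ _))//.
  apply: le_trans (_ : expR (t * (T%:R * `|c'|)) * expR (a * kap s) <= _); last first.
    by apply: ler_wpM2l; [exact: expR_ge0|exact: expR_kap].
  rewrite -expRD ler_expR.
  have h1 : tau * sigmaM X o s (sval xi) <= kap s.
    by apply: le_trans (ler_norm _) _; rewrite normrM tau1 mul1r sigma_le.
  have h2 : - (T%:R * c') <= T%:R * `|c'|.
    by rewrite -mulrN; apply: ler_wpM2l => //; rewrite -normrN ler_norm.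
  have : t * kap s <= a * kap s by apply: ler_wpM2r => //; exact: kap_ge0.
  have : t * (tau * sigmaM X o s (sval xi) - T%:R * c') <= t * (kap s + T%:R * `|c'|).
    by apply: ler_wpM2l; [exact: ltW|lra].
  by rewrite mulrDr; lra.
have dY T xi : dom (Y T xi) by eexists; exact: Yw.
(* Covers the last incomplete block, of length below [n0]. *)
pose C1 := expR (t * (n0%:R * `|c'|)) * (`|B| + 1) ^+ n0.
have C10 : 0 < C1 by rewrite mulr_gt0 ?expR_gt0// exprn_gt0// ltr_wpDl.
have psi T x xi : expect P T x (Y T xi) <= C1.
  elim/ltn_ind: T x xi => T IH x xi; have [Tn|nT] := ltnP T n0.
    apply: le_trans (ler_norm _) _.
    apply: le_trans (expect_abs kerP w1 wB T x (Yw T xi)) _.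
    have B1 := B_ge1 kerP w1 wB x; have Bn := ler_norm B.
    apply: ler_pM; rewrite ?expR_ge0 ?exprn_ge0 ?(le_trans ler01)//.
      rewrite ler_expR; apply: ler_wpM2l; first exact: ltW.
      by apply: ler_wpM2r => //; rewrite ler_nat ltnW.
    apply: (@le_trans _ _ ((`|B| + 1) ^+ T)).
      by apply: lerXn2r; rewrite ?nnegrE; lra.
    by apply: ler_weXn2l; [lra|exact: ltnW].
  rewrite -(subnKC nT) expectD.
  have split_Y s : expect P (T - n0) (last x s) (fun r => Y (n0 + (T - n0))%N xi (s ++ r)) =
      Y n0 xi s * expect P (T - n0) (last x s) (Y (T - n0)%N (actM s xi)).
    rewrite -(expect_scale kerP w1 wB)//; apply: eq_expect => r.
    by rewrite /Y -expRD sigma_cat natrD; congr expR; ring.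
  have dl := dominated_expect kerP w1 wB (T - n0) x (dY (n0 + (T - n0))%N xi).
  have dr := dominatedZ C1 (dY n0 xi).
  apply: le_trans (expect_le kerP w1 wB n0 x dl dr _) _ => [s|].
    rewrite split_Y mulrC; apply: ler_wpM2r; first exact: ltW.
    by apply: IH; rewrite ltn_subrL n00 (leq_trans n00).
  rewrite (expect_scale kerP w1 wB)// -[leRHS]mulr1.
  by apply: ler_wpM2l; [exact: ltW|exact: tP].
exists (t * (e / 2)), C1; split => //; first exact: mulr_gt0.
move=> x xi n.
apply: le_trans
  (_ : expect P n x (fun s => expR (- (t * (e / 2) * n%:R)) * Y n xi s) <= _).
  apply: (expect_le kerP w1 wB) => [||s].
  - by apply: (@dom_bounded 1) => s; rewrite normr_nat lern1 leq_b1.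
  - exact: dominatedZ.
  have [le|_] := leP (n%:R * c) (tau * sigmaM X o s (sval xi)); last first.
    by rewrite mulr_ge0 ?expR_ge0// ltW.
  apply: (@le_trans _ _ (expR 0)); first by rewrite expR0.
  rewrite /Y -expRD ler_expR.
  have : 0 <= t * (tau * sigmaM X o s (sval xi) - n%:R * c).
    by rewrite mulr_ge0 ?subr_ge0// ltW.
  by rewrite /c'; lra.
rewrite (expect_scale kerP w1 wB)// mulrC.
by apply: ler_wpM2r; [exact: expR_ge0|exact: psi].
Qed.

End Walk.

(** * The two-sided bound, assembled from the two tails *)

Theorem theorem3p6 (R : realType) (H : Type) (d : H -> H -> R) (o : H)
  (E : countType) (P : E -> E -> R) (pi : E -> R) (X : E -> isom d) :
  is_metric d -> geodesic d -> gromov_hyperbolic d ->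
  is_kernel P -> irreducible P -> positively_recurrent P ->
  stationary_probability P pi ->
  non_elementary X P o ->
  cond_A1 P pi -> cond_A2' X P o ->
  exists ell : R, 0 <= ell /\
    forall eps : R, 0 < eps ->
      exists alpha C : R, [/\ 0 < alpha, 0 < C &
        forall (x : E) (xi : H -> R) (n : nat),
          in_horo_compactification d o xi ->
          (Prob P x n (fun s => (n%:R * eps <= `|sigmaM X o s xi - n%:R * ell|)%R)
             <= (C * expR (- (alpha * n%:R)))%:E)%E ].
Proof.
move=> metd _ [delta [_ hyp]] kerP irr _ stat nonel A1 [a [B [a0 _ momB]]].
(* An ultrafilter containing all tails, hence non-principal. *)
have [U [UU Uoo]] := ultraFilterLemma (F := \oo) _.
(* [E] is nonempty because [pi] has total mass one. *)
have [x0] : exists x0 : E, True.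
  apply: contrapT => /forallNP h; case: stat => _ pi1 _.
  have : \esum_(y in [set: E]) (pi y)%:E = 0%E by apply: esum1 => y; case: (h y).
  by rewrite pi1 => /eqP; rewrite eqe oner_eq0.
move=> _; have doe := doeblin metd kerP a0 momB irr stat A1.
exists (drift o P X); split; first exact: (drift_ge0 metd kerP a0 momB x0).
move=> e e0; have e2 : 0 < e / 2 by lra.
have [n1 [n10 up]] := sigma_mean_upper metd kerP a0 momB x0 e2.
have [n2 [n20 lo]] := sigma_mean_lower metd kerP a0 momB Uoo hyp irr doe nonel x0 e2.
have [|al1 [C1 [al10 C10 ld1]]] := large_deviation metd kerP a0 momB
  (c := drift o P X + e) (normr1 R) e2 n10.
  by move=> x xi; rewrite mul1r; apply: le_trans (up x xi) _; rewrite ler_pM2l ?ltr0n//; lra.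
(* The lower tail of the cocycle is the upper tail of its negative, at level [e - drift]. *)
have [|al2 [C2 [al20 C20 ld2]]] := large_deviation metd kerP a0 momB
  (c := e - drift o P X) (normrN1 R) e2 n20.
  by move=> x xi; have := lo x xi; lra.
exists (Num.min al1 al2), (C1 + C2); split; [by rewrite lt_min al10|exact: addr_gt0|].
move=> x xi n hxi; pose eta : horo d o := exist _ xi hxi.
have w1 := wexp_ge1 o X metd a0.
rewrite (ProbE kerP w1 (wexp_mom momB)) lee_fin.
have dbool (F : seq E -> bool) : dominated (wexp o X a) (fun s => (F s)%:R).
  by apply: (@dom_bounded _ _ _ o _ X metd _ a0 1) => s; rewrite normr_nat lern1 leq_b1.
have := ld1 x eta n; have := ld2 x eta n => h2 h1.
have hexp al : Num.min al1 al2 <= al ->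
    expR (- (al * n%:R)) <= expR (- (Num.min al1 al2 * n%:R)).
  by move=> le; rewrite ler_expR lerN2; apply: ler_wpM2r.
apply: le_trans (_ : C1 * expR (- (al1 * n%:R)) + C2 * expR (- (al2 * n%:R)) <= _); last first.
  by rewrite mulrDl; apply: lerD; (apply: ler_wpM2l; [exact: ltW|]);
    apply: hexp; rewrite ge_min lexx ?orbT.
apply: le_trans (lerD h1 h2).
rewrite -(expect_add kerP w1 (wexp_mom momB)); [|exact: dbool|exact: dbool].
apply: (expect_le kerP w1 (wexp_mom momB)) => [||s]; first exact: dbool.
  by apply: dominatedD; exact: dbool.
rewrite -natrD ler_nat; case: asboolP => // h; rewrite /= mul1r mulN1r.
have : (n%:R * (drift o P X + e) <= sigmaM X o s xi) ||
    (n%:R * (e - drift o P X) <= - sigmaM X o s xi).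
  apply/orP; have [h'|h'] := leP 0 (sigmaM X o s xi - n%:R * drift o P X).
    by left; move: h; rewrite ger0_norm//; lra.
  by right; move: h; rewrite ltr0_norm//; lra.
by case: (_ <= _) => //=; case: (_ <= _).
Qed.
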